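(* Let $N\ge 2$, let $L$ be the $N\times N$ Jacobi matrix of the Toda lattice in Flaschka coordinates $(a_1,\dots,a_{N-1},b_1,\dots,b_N)$, let $\pi_1,\pi_2,\pi_3,\dots$ be the Toda hierarchy of Poisson tensors in these coordinates, let $H_1=\operatorname{tr} L=\sum_{i=1}^N b_i$ and $g=\ln(\det L)$. Then for every integer $j\ge 1$, on the open set where $\det L>0$, $$\mathcal{X}_{H_1}^{\pi_j}=\mathcal{X}_{g}^{\pi_{j+1}}.$$
   Context: Coordinates on $\mathbb{R}^{2N-1}$: $(x_1,\dots,x_{2N-1})=(a_1,\dots,a_{N-1},b_1,\dots,b_N)$, with the convention $a_0=a_N=0$ (and terms containing variables of index outside the allowed range are zero). $L$ is the symmetric tridiagonal matrix with $L_{ii}=b_i$, $L_{i,i+1}=L_{i+1,i}=a_i$, and other entries zero. A Poisson tensor $\pi$ is identified with its matrix $\pi_{ik}=\{x_i,x_k\}_\pi$. The Hamiltonian vector field of a function $h$ is $\mathcal{X}_h^{\pi}=\pi\nabla h$, i.e. its $x_i$-component is $\{x_i,h\}_\pi$. The Toda hierarchy $\pi_j$: - $\pi_1$ is given by $\{a_i,b_i\}=-a_i$, $\{a_i,b_{i+1}\}=a_i$ ($1\le i\le N-1$), all other brackets of coordinates zero. - $\pi_2$ is given by $\{a_i,a_{i+1}\}=\tfrac12 a_ia_{i+1}$, $\{a_i,b_i\}=-a_ib_i$, $\{a_i,b_{i+1}\}=a_ib_{i+1}$, $\{b_i,b_{i+1}\}=2a_i^2$, all other brackets zero. - The higher tensors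 are obtained by Lie derivatives along master symmetries $X_1,X_2$: $\pi_3=-\mathcal{L}_{X_1}\pi_2$, $\pi_4=-\tfrac12\mathcal{L}_{X_2}\pi_2$, and $\pi_{j+1}=\tfrac{1}{j-3}\mathcal{L}_{X_1}\pi_j$ for $j\ge4$ (instances of the known relations $\mathcal{L}_{X_i}\pi_j=(j-i-2)\pi_{i+j}$). Here $X_1=\sum_{i=1}^{N-1}A_i\frac{\partial}{\partial a_i}+\sum_{i=1}^NB_i\frac{\partial}{\partial b_i}$ with $$A_i=-i\,a_ib_i+(i+2)a_ib_{i+1},\qquad B_i=(2i+3)a_i^2+(1-2i)a_{i-1}^2+b_i^2,$$ and $X_2=\sum_{i=1}^{N-1}C_i\frac{\partial}{\partial a_i}+\sum_{i=1}^ND_i\frac{\partial}{\partial b_i}$ with $$C_i=(2-i)a_{i-1}^2a_i+(1-i)a_ib_i^2+a_ib_ib_{i+1}+(i+1)a_ia_{i+1}^2+(i+1)a_ib_{i+1}^2+a_i^3+\Big(\sum_{k=1}^{i-1}b_k\Big)a_i(b_{i+1}-b_i),$$ $$D_i=2\Big(\sum_{k=1}^{i-1}b_k\Big)a_i^2-2\Big(\sum_{k=1}^{i-2}b_k\Big)a_{i-1}^2+(2i+2)a_i^2b_i+(2i+1)a_i^2b_{i+1}+(3-2i)a_{i-1}^2b_{i-1}+(4-2i)a_{i-1}^2b_i+b_i^3.$$ *)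

(* Defs.v *)
From HB Require Import structures.
From mathcomp Require Import all_boot all_order all_algebra.
From mathcomp Require Import boolp classical_sets functions reals.
From mathcomp Require Import topology normedtype derive exp.
Import numFieldNormedType.Exports.
Set Implicit Arguments.
Unset Strict Implicit.
Unset Printing Implicit Defensive.
Import Order.TTheory GRing.Theory Num.Theory.
Local Open Scope ring_scope.

Section BivectorCalculus.
Variables (R : realType) (n : nat).

Definition partial (i : 'I_n) (f : 'rV[R]_n -> R) (x : 'rV[R]_n) : R :=
  'D_(delta_mx 0 i) f x.

(* A bivector field is given by its matrix pi_ik = {x_i, x_k}, and a vector
   field by the row of its components. *)
Definition bivector_field := 'rV[R]_n -> 'M[R]_n.
Definition vector_field := 'rV[R]_n -> 'rV[R]_n.

Definition hamiltonian (pi : bivector_field) (h : 'rV[R]_n -> R) :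
    vector_field :=
  fun x => \row_i \sum_k pi x i k * partial k h x.

(* (L_X pi)_ik = X(pi_ik) - sum_l pi_lk d_l X_i - sum_l pi_il d_l X_k *)
Definition Lie_derivative (X : vector_field) (pi : bivector_field) :
    bivector_field :=
  fun x => \matrix_(i, k) \sum_l
    (X x 0 l * partial l (fun y => pi y i k) x
     - pi x l k * partial l (fun y => X y 0 i) x
     - pi x i l * partial l (fun y => X y 0 k) x).

End BivectorCalculus.

(* 1-based coordinates, extended by 0 outside 1 <= i <= m. *)
Definition coord1 (R : realType) (m : nat) (v : 'rV[R]_m) (i : nat) : R :=
  if i is k.+1 then oapp (v 0) 0 (insub k) else 0.

Section Toda.
Variables (R : realType) (N : nat).

(* A point is the row (a_1, ..., a_(N-1), b_1, ..., b_N). *)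
Local Notation phase := 'rV[R]_(N.-1 + N).
Implicit Type x : phase.

Definition fl_a x (i : nat) : R := coord1 (lsubmx x) i.
Definition fl_b x (i : nat) : R := coord1 (rsubmx x) i.

Definition Lax x : 'M[R]_N :=
  \matrix_(i, j)
    if j == i then fl_b x i.+1
    else if j == i.+1 :> nat then fl_a x i.+1
    else if i == j.+1 :> nat then fl_a x j.+1
    else 0.

Definition toda_H1 x : R := \tr (Lax x).
Definition ln_det_Lax x : R := ln (\det (Lax x)).

(* The vector field sum_i Ca_i d/da_i + sum_i Cb_i d/db_i, and the bivector
   field with {a_i, a_j} = Paa i j, {a_i, b_j} = Pab i j = - {b_j, a_i},
   {b_i, b_j} = Pbb i j; all indices are 1-based. *)
Definition mk_vector_field (Ca Cb : phase -> nat -> R) :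
    vector_field R (N.-1 + N) :=
  fun x => row_mx (\row_i Ca x i.+1) (\row_i Cb x i.+1).

Definition mk_bivector_field (Paa Pab Pbb : phase -> nat -> nat -> R) :
    bivector_field R (N.-1 + N) :=
  fun x => block_mx
    (\matrix_(i, j) Paa x i.+1 j.+1) (\matrix_(i, j) Pab x i.+1 j.+1)
    (\matrix_(i, j) - Pab x j.+1 i.+1) (\matrix_(i, j) Pbb x i.+1 j.+1).

Definition toda_pi1 : bivector_field R (N.-1 + N) :=
  mk_bivector_field
    (fun _ _ _ => 0)
    (fun x i j => if j == i then - fl_a x i
                  else if j == i.+1 then fl_a x i else 0)
    (fun _ _ _ => 0).

Definition toda_pi2 : bivector_field R (N.-1 + N) :=
  mk_bivector_field
    (fun x i j => if j == i.+1 then 2^-1 * (fl_a x i * fl_a x j)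
                  else if i == j.+1 then - (2^-1 * (fl_a x j * fl_a x i))
                  else 0)
    (fun x i j => if j == i then - (fl_a x i * fl_b x i)
                  else if j == i.+1 then fl_a x i * fl_b x j else 0)
    (fun x i j => if j == i.+1 then 2 * fl_a x i ^+ 2
                  else if i == j.+1 then - (2 * fl_a x j ^+ 2) else 0).

Definition master_A x (i : nat) : R :=
  let a := fl_a x in let b := fl_b x in
  - i%:R * a i * b i + (i%:R + 2) * a i * b i.+1.

Definition master_B x (i : nat) : R :=
  let a := fl_a x in let b := fl_b x in
  (2 * i%:R + 3) * a i ^+ 2 + (1 - 2 * i%:R) * a i.-1 ^+ 2 + b i ^+ 2.

Definition master_C x (i : nat) : R :=
  let a := fl_a x in let b := fl_b x in
  (2 - i%:R) * a i.-1 ^+ 2 * a i + (1 - i%:R) * a i * b i ^+ 2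
  + a i * b i * b i.+1 + (i%:R + 1) * a i * a i.+1 ^+ 2
  + (i%:R + 1) * a i * b i.+1 ^+ 2 + a i ^+ 3
  + (\sum_(1 <= k < i) b k) * a i * (b i.+1 - b i).

Definition master_D x (i : nat) : R :=
  let a := fl_a x in let b := fl_b x in
  2 * (\sum_(1 <= k < i) b k) * a i ^+ 2
  - 2 * (\sum_(1 <= k < i.-1) b k) * a i.-1 ^+ 2
  + (2 * i%:R + 2) * a i ^+ 2 * b i + (2 * i%:R + 1) * a i ^+ 2 * b i.+1
  + (3 - 2 * i%:R) * a i.-1 ^+ 2 * b i.-1
  + (4 - 2 * i%:R) * a i.-1 ^+ 2 * b i + b i ^+ 3.

Definition master_X1 := mk_vector_field master_A master_B.
Definition master_X2 := mk_vector_field master_C master_D.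

(* The hierarchy starts at j = 1; the value at 0 is a dummy.  The last clause
   is pi_(j+1) = (j - 3)^-1 L_(X1) pi_j for j = k + 4. *)
Fixpoint toda_pi (j : nat) : bivector_field R (N.-1 + N) :=
  match j with
  | 0 => fun=> 0
  | 1 => toda_pi1
  | 2 => toda_pi2
  | 3 => fun x => - Lie_derivative master_X1 toda_pi2 x
  | 4 => fun x => - 2^-1 *: Lie_derivative master_X2 toda_pi2 x
  | (k.+4 as j').+1 =>
      fun x => k.+1%:R^-1 *: Lie_derivative master_X1 (toda_pi j') x
  end.

End Toda.

(* Main.v *)
Require Import Defs.
From mathcomp Require Import all_boot all_order all_algebra perm.
From mathcomp Require Import boolp classical_sets functions reals.
From mathcomp Require Import topology normedtype derive realfun exp.
From mathcomp Require Import ring zify.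
Import numFieldNormedType.Exports.
Set Implicit Arguments.
Unset Strict Implicit.
Unset Printing Implicit Defensive.
Import Order.TTheory GRing.Theory Num.Theory.
Local Open Scope classical_set_scope.
Local Open Scope ring_scope.

(** The theorem is the logarithmic end of the Lenard chain of the Toda lattice.
    In terms of the eigenvalues [l] of [L] it says that every [pi_(j+1)] sends
    the differential of [l] to [l] times its image under [pi_j]: then
    [pi_(j+1) d(ln det L)], which is the sum of [l^-1 pi_(j+1) dl], equals the
    sum of the [pi_j dl], that is [pi_j d(tr L)].  Eigenvalues are not
    differentiable where they collide, so the proof uses instead the traces
    [F_m = tr L^(m+1) / (m+1)], whose gradient is [v |-> tr (L^m dL(v))].  The
    chain becomes [pi_j dF_m = V_(m+j-1)], where [V_m = pi_1 dF_m] is the [m]-th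
    Toda flow: it depends on [m + j] only ([has_level_toda_pi]).

    To pass from the [F_m] to [ln det L], whose gradient is
    [v |-> tr (L^-1 dL(v))] by Jacobi's formula, write [L^-1] at the given point
    as a polynomial in [L] (Cayley-Hamilton, [invmx_polynomial]).  The
    contraction of [pi_(j+1)] with the gradient attached to a matrix [S] is
    linear in [S], so for [S] a polynomial in [L] it is the Toda flow attached
    to [S L^j].  For [S = L^-1] this is the flow attached to [L^(j-1)], which is
    also [pi_j dF_0].

    The chain itself is obtained by applying the Leibniz rule
    [(L_X pi) df = [X, pi df] - pi d(X f)] ([hamiltonian_Lie_derivative]) to the
    master symmetries [X_1] and [X_2].  Each satisfies a Lax equation with an
    inhomogeneous term, [X_n L = [K_n, L] + L^(n+1)], with [K_n] skew-symmetric,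
    tridiagonal for [n = 1] and pentadiagonal for [n = 2] ([Lax_master_X1],
    [Lax_master_X2]).  Hence [X_n F_m = (m+n+1) F_(m+n)], and a computation with
    entries near the diagonal gives [[X_n, V_m] = m V_(m+n)]
    ([bracket_master_X1], [bracket_master_X2]).  If [pi dF_m = V_(m+k)] for all
    [m], it follows that [(L_(X_n) pi) dF_m = (k - n - 1) V_(m+n+k)]
    ([has_level_Lie_derivative]), and the scalars in the definition of the
    hierarchy are exactly the inverses of these factors.  Starting from [pi_2],
    for which the relation is checked directly from the commutation of [L] with
    its powers ([hamiltonian_pi2]), this reaches every [pi_j]. *)

(** * Polynomial functions and their directional derivatives *)

Section PolynomialFunctions.
Variables (R : realType) (n : nat).
Local Notation V := 'rV[R]_n.
Implicit Types (f g : V -> R) (x v : V).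

Lemma is_derive_add x v f g df dg :
  is_derive x v f df -> is_derive x v g dg ->
  is_derive x v (fun y => f y + g y) (df + dg).
Proof. exact: is_deriveD. Qed.

Lemma is_derive_opp x v f df :
  is_derive x v f df -> is_derive x v (fun y => - f y) (- df).
Proof. exact: is_deriveN. Qed.

Lemma is_derive_mul x v f g df dg :
  is_derive x v f df -> is_derive x v g dg ->
  is_derive x v (fun y => f y * g y) (df * g x + f x * dg).
Proof.
move=> hf hg; apply: is_derive_eq (is_deriveM hf hg) _.
by rewrite addrC; congr (_ + _); exact: mulrC.
Qed.

Lemma is_derive_exp x v f df m :
  is_derive x v f df ->
  is_derive x v (fun y => f y ^+ m) (m%:R * f x ^+ m.-1 * df).
Proof.
move=> hf; have -> : (fun y => f y ^+ m) = f ^+ m.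
  apply/funext => y; elim: m => // m IH.
  by rewrite !exprS IH.
exact: is_deriveX.
Qed.

Lemma is_derive_const x v (c : R) : is_derive x v (fun _ : V => c) 0.
Proof. exact: is_derive_cst. Qed.

Lemma is_derive_bigsum I (r : seq I) (P : pred I) x v (f : I -> V -> R)
    (df : I -> R) :
  (forall i, is_derive x v (f i) (df i)) ->
  is_derive x v (fun y => \sum_(i <- r | P i) f i y) (\sum_(i <- r | P i) df i).
Proof.
move=> h; elim: r => [|i r IH].
  by under eq_fun do rewrite big_nil; rewrite big_nil; exact: is_derive_const.
under eq_fun do rewrite big_cons; rewrite big_cons.
by case: (P i) => //; exact: is_derive_add.
Qed.

(** The difference quotient of a linear form is constant off 0. *)
Lemma is_derive_linear x v f :
  (forall t y z, f (t *: y + z) = t * f y + f z) -> is_derive x v f (f v).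
Proof.
move=> lin.
have h : (fun h : R => h^-1 *: ((f \o shift x) (h *: v) - f x)) @ 0^' --> f v.
  apply: cvg_trans (@cvg_cst _ (f v) _ (0^' : set_system R) _).
  apply: near_eq_cvg; near=> h.
  rewrite /= lin addrK /GRing.scale /= mulKf //.
  by near: h; exact: nbhs_dnbhs_neq.
apply: DeriveDef; first by apply/cvg_ex; exists (f v).
exact: cvg_lim.
Unshelve. all: by end_near. Qed.

Lemma is_derive_unique x v f d d' :
  is_derive x v f d -> is_derive x v f d' -> d = d'.
Proof. by move=> [_ <-] [_ <-]. Qed.

Lemma is_derive_partial x l f d :
  is_derive x (delta_mx 0 l) f d -> partial l f x = d.
Proof. by case. Qed.

(** All fields of the hierarchy have polynomial components.  This class is closed
    under everything the Lie derivative does, and its members may be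
    differentiated freely, so no other smoothness notion is needed. *)
Inductive polyfun : (V -> R) -> Prop :=
| polyfun_const c : polyfun (fun=> c)
| polyfun_coord i : polyfun (fun x => x 0 i)
| polyfun_add f g : polyfun f -> polyfun g -> polyfun (fun x => f x + g x)
| polyfun_mul f g : polyfun f -> polyfun g -> polyfun (fun x => f x * g x).

Lemma polyfun_opp f : polyfun f -> polyfun (fun x => - f x).
Proof.
move=> hf; have := polyfun_mul (polyfun_const (-1)) hf.
by under eq_fun do rewrite mulN1r.
Qed.

Lemma polyfun_exp f m : polyfun f -> polyfun (fun x => f x ^+ m).
Proof.
move=> hf; elim: m => [|m IH]; first exact: polyfun_const.
by under eq_fun do rewrite exprS; exact: polyfun_mul.
Qed.

Lemma polyfun_sum I (r : seq I) (P : pred I) (f : I -> V -> R) :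
  (forall i, polyfun (f i)) -> polyfun (fun x => \sum_(i <- r | P i) f i x).
Proof.
move=> h; elim: r => [|i r IH].
  by under eq_fun do rewrite big_nil; exact: polyfun_const.
under eq_fun do rewrite big_cons.
by case: (P i) => //; exact: polyfun_add.
Qed.

Lemma is_derive_coord x v i : is_derive x v (fun y : V => y 0 i) (v 0 i).
Proof. by apply: (@is_derive_linear x v) => t y z; rewrite !mxE. Qed.

Lemma polyfun_gradient f : polyfun f -> exists G : 'I_n -> V -> R,
  (forall l, polyfun (G l)) /\
  forall x v, is_derive x v f (\sum_l v 0 l * G l x).
Proof.
elim=> {f} [c|i|f g pf [F [pF dF]] pg [G [pG dG]]
                |f g pf [F [pF dF]] pg [G [pG dG]]].
- exists (fun _ _ => 0); split=> [l|x v]; first exact: polyfun_const.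
  by rewrite big1 => [|l _]; [exact: is_derive_const|rewrite mulr0].
- exists (fun l _ => (l == i)%:R); split=> [l|x v]; first exact: polyfun_const.
  rewrite (bigD1 i) //= eqxx mulr1 big1 ?addr0; first exact: is_derive_coord.
  by move=> l /negPf->; rewrite mulr0.
- exists (fun l x => F l x + G l x); split=> [l|x v]; first exact: polyfun_add.
  under eq_bigr do rewrite mulrDr; rewrite big_split /=.
  exact: is_derive_add.
- exists (fun l x => F l x * g x + f x * G l x); split=> [l|x v].
    by apply: polyfun_add; exact: polyfun_mul.
  have -> : \sum_l v 0 l * (F l x * g x + f x * G l x) =
      (\sum_l v 0 l * F l x) * g x + f x * (\sum_l v 0 l * G l x).
    rewrite mulr_suml mulr_sumr -big_split /=; apply: eq_bigr => l _.
    by rewrite mulrDr mulrA (mulrCA (f x)).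
  exact: is_derive_mul.
Qed.

Lemma sum_delta_row l (c : 'I_n -> R) :
  \sum_k (delta_mx 0 l : V) 0 k * c k = c l.
Proof.
rewrite (bigD1 l) //= mxE !eqxx mul1r big1 ?addr0 // => k /negPf kl.
by rewrite mxE kl andbF mul0r.
Qed.

Lemma polyfun_is_derive f x v :
  polyfun f -> is_derive x v f (\sum_l v 0 l * partial l f x).
Proof.
move=> /polyfun_gradient[G [_ dG]]; apply: is_derive_eq (dG x v) _.
apply: eq_bigr => l _; congr (_ * _); apply/esym.
by rewrite (is_derive_partial (dG x _)) sum_delta_row.
Qed.

Lemma polyfun_is_derive_partial f x l :
  polyfun f -> is_derive x (delta_mx 0 l) f (partial l f x).
Proof.
by move=> pf; have := polyfun_is_derive x (delta_mx 0 l) pf; rewrite sum_delta_row.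
Qed.

Lemma polyfun_partial f l : polyfun f -> polyfun (partial l f).
Proof.
move=> /polyfun_gradient[G [pG dG]].
suff -> : partial l f = G l by exact: pG.
by apply/funext => x; rewrite (is_derive_partial (dG x _)) sum_delta_row.
Qed.

Lemma partial_add f g l : polyfun f -> polyfun g ->
  partial l (fun x => f x + g x) = fun x => partial l f x + partial l g x.
Proof.
move=> pf pg; apply/funext => x.
by apply: is_derive_partial; apply: is_derive_add; exact: polyfun_is_derive_partial.
Qed.

Lemma partial_mul f g l : polyfun f -> polyfun g ->
  partial l (fun x => f x * g x) =
  fun x => partial l f x * g x + f x * partial l g x.
Proof.
move=> pf pg; apply/funext => x.
by apply: is_derive_partial; apply: is_derive_mul; exact: polyfun_is_derive_partial.
Qed.

Lemma partial_const l c : partial l (fun _ : V => c) = fun=> 0.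
Proof. by apply/funext => x; apply: is_derive_partial; exact: is_derive_const. Qed.

(** Symmetry of second derivatives, by induction on the polynomial. *)
Lemma partial_comm f k l :
  polyfun f -> partial k (partial l f) = partial l (partial k f).
Proof.
elim=> {f} [c|i|f g pf cf pg cg|f g pf cf pg cg].
- by rewrite !partial_const.
- have h m : partial m (fun x : V => x 0 i) = fun=> (delta_mx 0 m : V) 0 i.
    by apply/funext => x; apply: is_derive_partial; exact: is_derive_coord.
  by rewrite !h !partial_const.
- have pp h m : polyfun h -> polyfun (partial m h) by exact: polyfun_partial.
  rewrite (partial_add l pf pg) (partial_add k pf pg).
  rewrite (partial_add k (pp f l pf) (pp g l pg)).
  by rewrite (partial_add l (pp f k pf) (pp g k pg)) cf cg.
- have pp h m : polyfun h -> polyfun (partial m h) by exact: polyfun_partial.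
  have step m m' : partial m (partial m' (fun x => f x * g x)) =
      fun x => (partial m (partial m' f) x * g x + partial m' f x * partial m g x)
             + (partial m f x * partial m' g x + f x * partial m (partial m' g) x).
    rewrite (partial_mul m' pf pg).
    rewrite (partial_add m (polyfun_mul (pp f m' pf) pg)
                           (polyfun_mul pf (pp g m' pg))).
    by rewrite (partial_mul m (pp f m' pf) pg) (partial_mul m pf (pp g m' pg)).
  by rewrite !step cf cg; apply/funext => x; ring.
Qed.

End PolynomialFunctions.

(** * The Lie derivative of a Hamiltonian vector field *)

Section LieDerivative.
Variables (R : realType) (n : nat).
Local Notation V := 'rV[R]_n.
Implicit Types (f g : V -> R) (X Y : vector_field R n) (pi : bivector_field R n).

Definition poly_vector_field X := forall i, polyfun (fun x => X x 0 i).
Definition poly_bivector_field pi := forall i k, polyfun (fun x => pi x i k).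

Definition dir X f : V -> R := fun x => \sum_l X x 0 l * partial l f x.

Definition bracket X Y : vector_field R n :=
  fun x => \row_i (dir X (fun y => Y y 0 i) x - dir Y (fun y => X y 0 i) x).

Lemma dir_is_derive X f x d : is_derive x (X x) f d -> polyfun f -> dir X f x = d.
Proof.
by move=> h /polyfun_is_derive-/(_ x (X x)) h'; exact: is_derive_unique h' h.
Qed.

Lemma poly_Lie_derivative X pi : poly_vector_field X ->
  poly_bivector_field pi -> poly_bivector_field (Lie_derivative X pi).
Proof.
move=> pX ppi i k; under eq_fun do rewrite mxE.
apply: polyfun_sum => l.
have pXp i' : polyfun (partial l (fun y => X y 0 i')) by exact: polyfun_partial.
apply: polyfun_add; first apply: polyfun_add.
- by apply: polyfun_mul; [exact: pX|exact: polyfun_partial].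
- by apply: polyfun_opp; apply: polyfun_mul.
- by apply: polyfun_opp; apply: polyfun_mul.
Qed.

Lemma partial_sum I (r : seq I) (f : I -> V -> R) l x :
  (forall i, polyfun (f i)) ->
  partial l (fun y => \sum_(i <- r) f i y) x = \sum_(i <- r) partial l (f i) x.
Proof.
move=> pf; apply: is_derive_partial; apply: is_derive_bigsum => i.
exact: polyfun_is_derive_partial.
Qed.

(** The Leibniz rule for the contraction of a bivector with a differential.
    Expanding both sides, the terms with first derivatives of [pi] and [X]
    match one by one, and the second derivatives of [f] cancel because they are
    symmetric. *)
Lemma hamiltonian_Lie_derivative X pi f :
  poly_vector_field X -> poly_bivector_field pi -> polyfun f ->
  hamiltonian (Lie_derivative X pi) f =
  fun x => bracket X (hamiltonian pi f) x - hamiltonian pi (dir X f) x.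
Proof.
move=> pX ppi pf; apply/funext => x; apply/rowP => i; rewrite !mxE.
under eq_bigr do rewrite mxE mulr_suml.
have pp l : polyfun (partial l f) by exact: polyfun_partial.
have -> : dir X (fun y => hamiltonian pi f y 0 i) x =
    \sum_k \sum_l X x 0 l * (partial l (fun y => pi y i k) x * partial k f x
                              + pi x i k * partial l (partial k f) x).
  rewrite exchange_big; apply: eq_bigr => l _; rewrite -mulr_sumr.
  congr (_ * _); under [X in partial l X]eq_fun do rewrite mxE.
  rewrite partial_sum => [|k]; last exact: polyfun_mul.
  by apply: eq_bigr => k _; rewrite partial_mul.
have -> : dir (hamiltonian pi f) (fun y => X y 0 i) x =
    \sum_k \sum_l pi x l k * partial k f x * partial l (fun y => X y 0 i) x.
  rewrite exchange_big; apply: eq_bigr => l _ /=.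
  by rewrite mxE mulr_suml.
have -> : \sum_k pi x i k * partial k (dir X f) x =
    \sum_k \sum_l pi x i l * (partial l (fun y => X y 0 k) x * partial k f x
                              + X x 0 k * partial l (partial k f) x).
  rewrite exchange_big; apply: eq_bigr => l _; rewrite -mulr_sumr; congr (_ * _).
  rewrite /dir partial_sum => [|k]; last exact: polyfun_mul.
  by apply: eq_bigr => k _; rewrite partial_mul.
have sym : \sum_k \sum_l X x 0 l * pi x i k * partial l (partial k f) x =
           \sum_k \sum_l X x 0 k * pi x i l * partial l (partial k f) x.
  rewrite exchange_big; apply: eq_bigr => k _; apply: eq_bigr => l _.
  by rewrite partial_comm.
apply/eqP; rewrite -subr_eq0 -!sumrB; apply/eqP.
transitivity (\sum_k \sum_l (X x 0 k * pi x i l * partial l (partial k f) x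
   - X x 0 l * pi x i k * partial l (partial k f) x)).
  apply: eq_bigr => k _; rewrite -!sumrB; apply: eq_bigr => l _.
  by ring.
under eq_bigr do rewrite sumrB; rewrite sumrB sym; exact: subrr.
Qed.

End LieDerivative.

Arguments fl_a : simpl never.
Arguments fl_b : simpl never.

(** * Matrix entries with 1-based indices *)

Section OneBased.
Variable R : realType.

(** The coordinates of the Toda lattice are numbered from 1 and vanish outside
    their range.  Functions on [nat] with this property make every local formula
    valid at the ends of the chain as well as inside it. *)
Definition supported (m : nat) (G : nat -> R) :=
  forall i, ~~ (0 < i <= m)%N -> G i = 0.

Lemma coord1_ord m (v : 'rV[R]_m) (k : 'I_m) : coord1 v k.+1 = v 0 k.
Proof.
rewrite /coord1 /= (insubT (fun i => i < m)%N (ltn_ord k)) /=.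
by congr (v _ _); apply: val_inj.
Qed.

Lemma coord1_supported m (v : 'rV[R]_m) : supported m (coord1 v).
Proof. by case=> [|k] //= km; rewrite insubF //; apply: negbTE. Qed.

Lemma in_rangeP m i : reflect (exists k : 'I_m, i = k.+1) (0 < i <= m)%N.
Proof.
apply: (iffP idP) => [/andP[i0 im]|[k ->]]; last by rewrite /= ltn_ord.
by case: i i0 im => // i _ im; exists (Ordinal im).
Qed.

Lemma coord1_row m (G : nat -> R) : supported m G ->
  forall i, coord1 (\row_(k < m) G k.+1) i = G i.
Proof.
move=> h i; case: (boolP (0 < i <= m)%N) => [/in_rangeP[k ->]|im].
  by rewrite coord1_ord mxE.
by rewrite (coord1_supported _ im) h.
Qed.

Lemma sum_pick m (G : nat -> R) i : supported m G ->
  \sum_(k < m) (k.+1 == i)%:R * G k.+1 = G i.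
Proof.
move=> h; case: (boolP (0 < i <= m)%N) => [/in_rangeP[k ->]|im].
  rewrite (bigD1 k) //= eqxx mul1r big1 ?addr0 // => l lk.
  by rewrite eqSS (inj_eq val_inj) (negPf lk) mul0r.
rewrite h // big1 // => k _; case: eqP => [E|_]; last by rewrite mul0r.
by case/negP: im; rewrite -E /= ltn_ord.
Qed.

Variable N : nat.
Implicit Types (S T : 'M[R]_N) (x : 'rV[R]_(N.-1 + N)).

Definition entry1 S (i j : nat) : R :=
  coord1 (\row_k coord1 (row k S) j) i.

Arguments entry1 : simpl never.

Lemma entry1_ord S (i j : 'I_N) : entry1 S i.+1 j.+1 = S i j.
Proof. by rewrite /entry1 coord1_ord mxE coord1_ord mxE. Qed.

Lemma entry1_supported_row S j : supported N (entry1 S ^~ j).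
Proof. by move=> i; exact: coord1_supported. Qed.

Lemma entry1_supported_col S i : supported N (entry1 S i).
Proof.
move=> j Nj; case: (boolP (0 < i <= N)%N) => [/in_rangeP[k ->]|Ni].
  by rewrite /entry1 coord1_ord mxE coord1_supported.
by rewrite entry1_supported_row.
Qed.

Lemma entry1_matrix (F : nat -> nat -> R) :
  (forall j, supported N (F ^~ j)) -> (forall i, supported N (F i)) ->
  forall i j, entry1 (\matrix_(i, j) F i.+1 j.+1) i j = F i j.
Proof.
move=> h1 h2 i j.
case: (boolP (0 < i <= N)%N) => [/in_rangeP[k ->]|Ni]; last first.
  by rewrite entry1_supported_row // h1.
case: (boolP (0 < j <= N)%N) => [/in_rangeP[l ->]|Nj]; last first.
  by rewrite entry1_supported_col // h2.
by rewrite entry1_ord mxE.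
Qed.

(** To identify all 1-based entries of a matrix it suffices to look at the genuine
    ones, provided that the candidate formula vanishes outside the matrix. *)
Lemma entry1_def S (F : nat -> nat -> R) :
  (forall j, supported N (F ^~ j)) -> (forall i, supported N (F i)) ->
  (forall k l : 'I_N, S k l = F k.+1 l.+1) ->
  forall i j, entry1 S i j = F i j.
Proof.
move=> h1 h2 h i j; rewrite -(entry1_matrix h1 h2); congr (entry1 _ i j).
by apply/matrixP => k l; rewrite h mxE.
Qed.

Lemma eq_entry1 S T :
  (forall i j, entry1 S i j = entry1 T i j) -> S = T.
Proof. by move=> h; apply/matrixP => i j; rewrite -!entry1_ord h. Qed.

Lemma entry1D S T i j : entry1 (S + T) i j = entry1 S i j + entry1 T i j.
Proof.
move: i j; apply: entry1_def => [l k Nk|k l Nl|k l] /=.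
- by rewrite !entry1_supported_row ?addr0.
- by rewrite !entry1_supported_col ?addr0.
- by rewrite mxE !entry1_ord.
Qed.

Lemma entry1Z c S i j : entry1 (c *: S) i j = c * entry1 S i j.
Proof.
move: i j; apply: entry1_def => [l k Nk|k l Nl|k l] /=.
- by rewrite entry1_supported_row ?mulr0.
- by rewrite entry1_supported_col ?mulr0.
- by rewrite mxE entry1_ord.
Qed.

Lemma entry1N S i j : entry1 (- S) i j = - entry1 S i j.
Proof. by rewrite -scaleN1r entry1Z mulN1r. Qed.

Lemma entry1_tr S i j : entry1 S^T i j = entry1 S j i.
Proof.
move: i j; apply: entry1_def => [l|k|k l] /=.
- exact: entry1_supported_col.
- exact: entry1_supported_row.
- by rewrite mxE !entry1_ord.
Qed.

Lemma entry1_sym S i j : S^T = S -> entry1 S i j = entry1 S j i.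
Proof. by move=> {1}<-; rewrite entry1_tr. Qed.

Lemma entry1M S T i j :
  entry1 (S *m T) i j = \sum_(k < N) entry1 S i k.+1 * entry1 T k.+1 j.
Proof.
move: i j; apply: entry1_def => [l k Nk|k l Nl|k l] /=.
- by rewrite big1 // => m _; rewrite (entry1_supported_row S _ Nk) mul0r.
- by rewrite big1 // => m _; rewrite (entry1_supported_col T _ Nl) mulr0.
- by rewrite mxE; apply: eq_bigr => m _; rewrite !entry1_ord.
Qed.

Lemma mxtrace_entry1 S : \tr S = \sum_(k < N) entry1 S k.+1 k.+1.
Proof. by apply: eq_bigr => k _; rewrite entry1_ord. Qed.

(** When [i <= c] no index is picked, and the truncated difference is 0, where
    [G] vanishes. *)
Lemma sum_pick_pred m (G : nat -> R) (i c : nat) : supported m G ->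
  \sum_(k < m) (i == k.+1 + c)%N%:R * G k.+1 = G (i - c)%N.
Proof.
move=> h; rewrite -(sum_pick (i - c)%N h); apply: eq_bigr => k _.
by congr (_%:R * _); lia.
Qed.

(** * Banded matrices *)

Lemma fl_a_supported x : supported N.-1 (fl_a x).
Proof. exact: coord1_supported. Qed.

Lemma fl_b_supported x : supported N (fl_b x).
Proof. exact: coord1_supported. Qed.

Lemma fl_a0 x : fl_a x 0 = 0. Proof. by []. Qed.
Lemma fl_b0 x : fl_b x 0 = 0. Proof. by []. Qed.

Lemma entry1_Lax x i j :
  entry1 (Lax x) i j =
  (j == i)%:R * fl_b x i + (j == i.+1)%:R * fl_a x i + (i == j.+1)%:R * fl_a x j.
Proof.
move: i j; apply: entry1_def => [l k Nk|k l Nl|k l] /=.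
- rewrite fl_b_supported // fl_a_supported; last by lia.
  rewrite !mulr0 !add0r; case: eqP => [E|_]; last by rewrite mul0r.
  by rewrite fl_a_supported ?mulr0 //; lia.
- rewrite (fl_a_supported x (i := l)); last by lia.
  have -> : (l == k)%:R * fl_b x k = 0.
    by case: eqP => [E|_]; rewrite ?mul0r // fl_b_supported ?mulr0 //; lia.
  have -> : (l == k.+1)%:R * fl_a x k = 0.
    by case: eqP => [E|_]; rewrite ?mul0r // fl_a_supported ?mulr0 //; lia.
  by rewrite mulr0 !addr0.
- rewrite mxE -(inj_eq val_inj) /= !eqSS.
  case: (ltngtP l k) => h.
  + have -> : (l == k.+1 :> nat) = false by lia.
    by case: eqP => _; rewrite ?mul0r ?mul1r ?add0r ?addr0.
  + have -> : (k == l.+1 :> nat) = false by lia.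
    by case: eqP => _; rewrite ?mul0r ?mul1r ?add0r ?addr0.
  + have -> : (k == l.+1 :> nat) = false by lia.
    have -> : (l == k.+1 :> nat) = false by lia.
    by rewrite !mul0r mul1r !addr0.
Qed.

Lemma entry1_Lax_diag x i : entry1 (Lax x) i i = fl_b x i.
Proof. by rewrite entry1_Lax eqxx ltn_eqF // mul0r mul1r !addr0. Qed.

Lemma entry1_Lax_up x i : entry1 (Lax x) i i.+1 = fl_a x i.
Proof.
rewrite entry1_Lax eqxx; have -> : (i.+1 == i) = false by lia.
have -> : (i == i.+2) = false by lia.
by rewrite !mul0r mul1r add0r addr0.
Qed.

Lemma Lax_tr x : (Lax x)^T = Lax x.
Proof.
apply/eq_entry1 => i j; rewrite entry1_tr !entry1_Lax (eq_sym i j).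
by case: eqP => [->|_]; rewrite ?mul0r; ring.
Qed.

Lemma entry1_Lax_low x i : entry1 (Lax x) i.+1 i = fl_a x i.
Proof. by rewrite entry1_sym ?Lax_tr // entry1_Lax_up. Qed.

Lemma entry1_Lax_far x i j :
  (i.+1 < j)%N || (j.+1 < i)%N -> entry1 (Lax x) i j = 0.
Proof.
move=> h; rewrite entry1_Lax.
have [-> -> ->] : [/\ (j == i) = false, (j == i.+1) = false & (i == j.+1) = false].
  by split; lia.
by rewrite !mul0r !addr0.
Qed.

Lemma entry1_Lax_mul x S i j :
  entry1 (Lax x *m S) i j = fl_a x i.-1 * entry1 S i.-1 j
    + fl_b x i * entry1 S i j + fl_a x i * entry1 S i.+1 j.
Proof.
rewrite entry1M.
under eq_bigr do rewrite entry1_Lax !mulrDl -!mulrA.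
rewrite !big_split /=.
have hS c : supported N (fun k => c * entry1 S k j).
  by move=> k Nk; rewrite entry1_supported_row ?mulr0.
rewrite (sum_pick i (hS (fl_b x i))) (sum_pick i.+1 (hS (fl_a x i))).
have h : supported N (fun k => fl_a x k * entry1 S k j).
  by move=> k Nk; rewrite entry1_supported_row ?mulr0.
under [X in _ + X]eq_bigr do rewrite -addn1.
by rewrite (sum_pick_pred i 1 h) subn1; ring.
Qed.

Lemma entry1_mul_Lax x S i j :
  entry1 (S *m Lax x) i j = entry1 S i j.-1 * fl_a x j.-1
    + entry1 S i j * fl_b x j + entry1 S i j.+1 * fl_a x j.
Proof.
by rewrite -entry1_tr trmx_mul Lax_tr entry1_Lax_mul !entry1_tr; ring.
Qed.

(** The skew-symmetric matrix with first superdiagonal [q] and second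
    superdiagonal [p]. *)
Definition skew_entry (q p : nat -> R) (i j : nat) : R :=
  (j == i + 1)%N%:R * q i + (j == i + 2)%N%:R * p i
  - (i == j + 1)%N%:R * q j - (i == j + 2)%N%:R * p j.

Definition skew_band (q p : nat -> R) : 'M[R]_N :=
  \matrix_(i, j) skew_entry q p i.+1 j.+1.

Lemma skew_entryN q p i j : skew_entry q p j i = - skew_entry q p i j.
Proof. by rewrite /skew_entry; ring. Qed.

Lemma skew_band_tr q p : (skew_band q p)^T = - skew_band q p.
Proof. by apply/matrixP => i j; rewrite !mxE skew_entryN. Qed.

Lemma entry1_skew_band q p i j : supported N.-1 q -> supported N.-2 p ->
  entry1 (skew_band q p) i j = skew_entry q p i j.
Proof.
move=> hq hp.
have z l : supported N (skew_entry q p ^~ l).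
  move=> k Nk; rewrite /skew_entry (hq k) ?(hp k); [|lia..].
  have -> : (k == l + 1)%N%:R * q l = 0.
    by case: eqP => [E|_]; rewrite ?mul0r // hq ?mulr0 //; lia.
  have -> : (k == l + 2)%N%:R * p l = 0.
    by case: eqP => [E|_]; rewrite ?mul0r // hp ?mulr0 //; lia.
  by ring.
apply: entry1_matrix => // k l Nl.
by rewrite skew_entryN z ?oppr0.
Qed.

Lemma entry1_skew_band_mul q p S i j : supported N.-1 q -> supported N.-2 p ->
  entry1 (skew_band q p *m S) i j =
  q i * entry1 S i.+1 j + p i * entry1 S i.+2 j
  - q (i - 1)%N * entry1 S (i - 1) j - p (i - 2)%N * entry1 S (i - 2) j.
Proof.
move=> hq hp; rewrite entry1M.
under eq_bigr do rewrite entry1_skew_band // /skew_entry !mulrDl !mulNr -!mulrA.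
rewrite !big_split /= !sumrN.
have hS c : supported N (fun k => c k * entry1 S k j).
  by move=> k Nk; rewrite entry1_supported_row ?mulr0.
rewrite (sum_pick (i + 1)%N (hS (fun=> q i))) (sum_pick (i + 2)%N (hS (fun=> p i))).
by rewrite (sum_pick_pred i 1 (hS q)) (sum_pick_pred i 2 (hS p)) addn1 addn2.
Qed.

Lemma entry1_mul_skew_band q p S i j : supported N.-1 q -> supported N.-2 p ->
  entry1 (S *m skew_band q p) i j =
  entry1 S i (j - 1) * q (j - 1)%N + entry1 S i (j - 2) * p (j - 2)%N
  - entry1 S i j.+1 * q j - entry1 S i j.+2 * p j.
Proof.
move=> hq hp; rewrite -entry1_tr trmx_mul skew_band_tr mulNmx entry1N.
by rewrite entry1_skew_band_mul // !entry1_tr; ring.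
Qed.

End OneBased.

Arguments entry1 : simpl never.

(** * Lax equations of the master symmetries *)

Section LaxEquations.
Variables (R : realType) (N : nat).
Local Notation phase := 'rV[R]_(N.-1 + N).
Implicit Types (x v : phase) (S : 'M[R]_N).

Lemma fl_a_mk (Ca Cb : phase -> nat -> R) x i : supported N.-1 (Ca x) ->
  fl_a (mk_vector_field Ca Cb x) i = Ca x i.
Proof. by move=> h; rewrite /fl_a /mk_vector_field row_mxKl coord1_row. Qed.

Lemma fl_b_mk (Ca Cb : phase -> nat -> R) x i : supported N (Cb x) ->
  fl_b (mk_vector_field Ca Cb x) i = Cb x i.
Proof. by move=> h; rewrite /fl_b /mk_vector_field row_mxKr coord1_row. Qed.

Definition sumb x i : R := \sum_(1 <= k < i) fl_b x k.

Lemma sumbS x i : sumb x i.+1 = sumb x i + fl_b x i.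
Proof.
rewrite /sumb; case: i => [|i]; last by rewrite big_nat_recr.
by rewrite !big_geq // fl_b0 addr0.
Qed.

Lemma sumb0 x : sumb x 0 = 0. Proof. exact: big_geq. Qed.
Lemma sumb1 x : sumb x 1 = 0. Proof. exact: big_geq. Qed.

Lemma master_A_supported x : supported N.-1 (master_A x).
Proof. by move=> i Ni; rewrite /master_A fl_a_supported //; ring. Qed.

Lemma master_C_supported x : supported N.-1 (master_C x).
Proof. by move=> i Ni; rewrite /master_C (fl_a_supported x Ni); ring. Qed.

Lemma master_B_supported x : supported N (master_B x).
Proof.
move=> i Ni; rewrite /master_B (fl_b_supported x Ni).
rewrite (fl_a_supported x (i := i)) ?(fl_a_supported x (i := i.-1)); [ring|lia..].
Qed.

Lemma master_D_supported x : supported N (master_D x).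
Proof.
move=> i Ni; rewrite /master_D (fl_b_supported x Ni).
rewrite (fl_a_supported x (i := i)) ?(fl_a_supported x (i := i.-1)); [ring|lia..].
Qed.

(** The off-diagonals of the skew matrices [K_1] and [K_2] come from solving
    [X_n L = [K_n, L] + L^(n+1)] from the outside in: the entries on the outer
    diagonals, where the left side vanishes, give recursions in [i], and the
    entries next to the main diagonal fix the constants of integration. *)
Definition lax_q1 x i : R := (i%:R + 1) * fl_a x i.
Definition lax_q2 x i : R :=
  fl_a x i * (i%:R * (fl_b x i + fl_b x i.+1) + sumb x i).
Definition lax_p2 x i : R := i%:R * fl_a x i * fl_a x i.+1.

Definition lax_part1 x : 'M[R]_N := skew_band N (lax_q1 x) (fun=> 0).
Definition lax_part2 x : 'M[R]_N := skew_band N (lax_q2 x) (lax_p2 x).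

Lemma lax_q1_supported x : supported N.-1 (lax_q1 x).
Proof. by move=> i Ni; rewrite /lax_q1 fl_a_supported ?mulr0. Qed.

Lemma lax_q2_supported x : supported N.-1 (lax_q2 x).
Proof. by move=> i Ni; rewrite /lax_q2 fl_a_supported ?mul0r. Qed.

Lemma lax_p2_supported x : supported N.-2 (lax_p2 x).
Proof.
case=> [|i] Ni; first by rewrite /lax_p2 !mul0r.
by rewrite /lax_p2 (fl_a_supported x (i := i.+2)) ?mulr0 //; lia.
Qed.

Lemma zero_supported m : supported m (fun=> 0 : R).
Proof. by []. Qed.

(** Both sides of a Lax equation are symmetric, so only the diagonals above the
    main one have to be compared, each at a fixed distance [d]. *)
Lemma eq_sym_entry1 S T : S^T = S -> T^T = T ->
  (forall i d, entry1 S i.+1 (i.+1 + d) = entry1 T i.+1 (i.+1 + d)) -> S = T.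
Proof.
move=> sS sT h.
have le i j : (i <= j)%N -> entry1 S i.+1 j.+1 = entry1 T i.+1 j.+1.
  by move=> ij; rewrite -(subnKC ij) -addSn h.
apply/matrixP => i j; rewrite -!entry1_ord.
case: (leqP i j) => [|/ltnW] ij; first exact: le.
by rewrite entry1_sym // le // entry1_sym.
Qed.

Lemma entry1_0 S j : entry1 S 0 j = 0. Proof. by []. Qed.

Lemma entry1_col0 S i : entry1 S i 0 = 0.
Proof. by rewrite entry1_supported_col. Qed.

Lemma pow_tr S m : S^T = S -> (S ^+ m)^T = S ^+ m.
Proof.
move=> sS; elim: m => [|m IH]; first by rewrite expr0; exact: trmx1.
by rewrite {1}exprS trmx_mul sS IH exprSr.
Qed.

Lemma commutator_tr S T : S^T = - S -> T^T = T ->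
  (S *m T - T *m S)^T = S *m T - T *m S.
Proof.
by move=> sS sT; rewrite linearB /= !trmx_mul sS sT mulmxN mulNmx opprK addrC.
Qed.

Lemma entry1_commutator q p S i j : supported N.-1 q -> supported N.-2 p ->
  entry1 (skew_band N q p *m S - S *m skew_band N q p) i j =
  q i * entry1 S i.+1 j + p i * entry1 S i.+2 j
  - q (i - 1)%N * entry1 S (i - 1) j - p (i - 2)%N * entry1 S (i - 2) j
  - (entry1 S i (j - 1) * q (j - 1)%N + entry1 S i (j - 2) * p (j - 2)%N
     - entry1 S i j.+1 * q j - entry1 S i j.+2 * p j).
Proof.
move=> hq hp.
by rewrite entry1D entry1N entry1_skew_band_mul // entry1_mul_skew_band.
Qed.

Let LaxE := (entry1_Lax_diag, entry1_Lax_up, entry1_Lax_low, entry1_0, entry1_col0).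

(** Beyond the second superdiagonal every term vanishes, so only the distances
    0, 1 and 2 have content; distance 2 expresses the choice of [lax_q1]. *)
Lemma Lax_master_X1 x : Lax (master_X1 x) =
  lax_part1 x *m Lax x - Lax x *m lax_part1 x + Lax x ^+ 2.
Proof.
have hq := @lax_q1_supported x; have hp := @zero_supported N.-2.
apply: eq_sym_entry1 => [||i d]; first exact: Lax_tr.
  rewrite linearD /= pow_tr ?Lax_tr // commutator_tr ?Lax_tr //.
  exact: skew_band_tr.
rewrite entry1D entry1_commutator // entry1_Lax_mul !(mul0r, mulr0, subr0, addr0).
case: d => [|[|[|d]]]; rewrite ?addn0 ?addn1 ?addn2 ?addn3.
- rewrite !LaxE fl_b_mk; last exact: master_B_supported.
  by rewrite !subSS !subn0 /= !LaxE /lax_q1 /master_B /=; ring.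
- rewrite !LaxE fl_a_mk; last exact: master_A_supported.
  rewrite !subSS !subn0 /= ?LaxE !entry1_Lax_far; [|lia..].
  by rewrite /lax_q1 /master_A /=; ring.
- rewrite !subSS !subn0 /= ?LaxE !entry1_Lax_far; [|lia..].
  by rewrite /lax_q1 /=; ring.
- rewrite !entry1_Lax_far; [ring|lia..].
Qed.

Lemma Lax_master_X2 x : Lax (master_X2 x) =
  lax_part2 x *m Lax x - Lax x *m lax_part2 x + Lax x ^+ 3.
Proof.
have hq := @lax_q2_supported x; have hp := @lax_p2_supported x.
apply: eq_sym_entry1 => [||i d]; first exact: Lax_tr.
  rewrite linearD /= pow_tr ?Lax_tr // commutator_tr ?Lax_tr //.
  exact: skew_band_tr.
rewrite entry1D entry1_commutator // entry1_Lax_mul !entry1_Lax_mul.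
case: d => [|[|[|[|d]]]]; rewrite ?addn0 ?addn1 ?addn2 ?addn3.
- rewrite !LaxE fl_b_mk; last exact: master_D_supported.
  case: i => [|i]; rewrite ?(subSS, subn0) /= ?LaxE ?entry1_Lax_far; try lia.
    rewrite /lax_q2 /lax_p2 /master_D /= -!/(sumb _ _) !sumbS !fl_a0 !fl_b0 !sumb0.
    by ring.
  rewrite /lax_q2 /lax_p2 /master_D /= -!/(sumb _ _) !sumbS.
  by ring.
- rewrite !LaxE fl_a_mk; last exact: master_C_supported.
  case: i => [|i]; rewrite ?(subSS, subn0) /= ?LaxE ?entry1_Lax_far; try lia.
    rewrite /lax_q2 /lax_p2 /master_C /= -!/(sumb _ _) !sumbS !fl_a0 !fl_b0 !sumb0.
    by ring.
  rewrite /lax_q2 /lax_p2 /master_C /= -!/(sumb _ _) !sumbS.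
  by ring.
- rewrite !LaxE; case: i => [|i];
    rewrite ?(subSS, subn0) /= ?LaxE ?entry1_Lax_far; try lia.
    rewrite /lax_q2 /lax_p2 /= !sumbS !fl_a0 !fl_b0 !sumb0.
    by ring.
  rewrite /lax_q2 /lax_p2 /= !sumbS.
  by ring.
- rewrite !LaxE; case: i => [|i];
    rewrite ?(subSS, subn0) /= ?LaxE ?entry1_Lax_far; try lia.
    rewrite /lax_q2 /lax_p2 /= !sumbS !fl_a0 !fl_b0 !sumb0.
    by ring.
  rewrite /lax_q2 /lax_p2 /= !sumbS.
  by ring.
- rewrite !entry1_Lax_far; [ring|lia..].
Qed.
End LaxEquations.

(** * Derivatives of the powers of the Lax matrix *)

Section PowerDerivatives.
Variables (R : realType) (N : nat).
Local Notation phase := 'rV[R]_(N.-1 + N).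
Implicit Types (x v : phase) (S K : 'M[R]_N).

Definition mx_derive x v (A : phase -> 'M[R]_N) (dA : 'M[R]_N) :=
  forall i j, is_derive x v (fun y => A y i j) (dA i j).

Lemma coord1_is_linear m t (u w : 'rV[R]_m) i :
  coord1 (t *: u + w) i = t * coord1 u i + coord1 w i.
Proof.
case: (boolP (0 < i <= m)%N) => [/in_rangeP[k ->]|im].
  by rewrite !coord1_ord !mxE.
by rewrite !coord1_supported // mulr0 addr0.
Qed.

Lemma fl_a_linear t x y i : fl_a (t *: x + y) i = t * fl_a x i + fl_a y i.
Proof. by rewrite /fl_a linearP coord1_is_linear. Qed.

Lemma fl_b_linear t x y i : fl_b (t *: x + y) i = t * fl_b x i + fl_b y i.
Proof. by rewrite /fl_b linearP coord1_is_linear. Qed.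

Lemma is_derive_fl_a x v i : is_derive x v (fun y : phase => fl_a y i) (fl_a v i).
Proof. by apply: is_derive_linear => t y z; exact: fl_a_linear. Qed.

Lemma is_derive_fl_b x v i : is_derive x v (fun y : phase => fl_b y i) (fl_b v i).
Proof. by apply: is_derive_linear => t y z; exact: fl_b_linear. Qed.

Lemma mx_derive_Lax x v : mx_derive x v (@Lax R N) (Lax v).
Proof.
move=> i j; apply: is_derive_linear => t y z.
rewrite -!entry1_ord !entry1_Lax !fl_a_linear !fl_b_linear; ring.
Qed.

Lemma mx_derive_mul x v A B dA dB : mx_derive x v A dA -> mx_derive x v B dB ->
  mx_derive x v (fun y => A y *m B y) (dA *m B x + A x *m dB).
Proof.
move=> hA hB i j; under eq_fun do rewrite mxE.
rewrite !mxE -big_split /=; apply: is_derive_bigsum => k.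
exact: is_derive_mul.
Qed.

Lemma is_derive_entry1 x v A dA i j : mx_derive x v A dA ->
  is_derive x v (fun y => entry1 (A y) i j) (entry1 dA i j).
Proof.
move=> h; case: (boolP (0 < i <= N)%N) => [/in_rangeP[k ->]|Ni]; last first.
  rewrite entry1_supported_row //.
  under eq_fun do rewrite entry1_supported_row //; exact: is_derive_const.
case: (boolP (0 < j <= N)%N) => [/in_rangeP[l ->]|Nj]; last first.
  rewrite entry1_supported_col //.
  under eq_fun do rewrite entry1_supported_col //; exact: is_derive_const.
rewrite entry1_ord; under eq_fun do rewrite entry1_ord; exact: h.
Qed.

Lemma is_derive_trace x v A dA : mx_derive x v A dA ->
  is_derive x v (fun y => \tr (A y)) (\tr dA).
Proof. by move=> h; apply: is_derive_bigsum => i. Qed.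

(** The derivative of [A ^+ m] along a curve with velocity [B]. *)
Fixpoint dpow (A B : 'M[R]_N) m : 'M[R]_N :=
  if m is k.+1 then B *m A ^+ k + A *m dpow A B k else 0.

Lemma mx_derive_pow x v m :
  mx_derive x v (fun y => Lax y ^+ m) (dpow (Lax x) (Lax v) m).
Proof.
elim: m => [|m IH] /=.
  by move=> i j; rewrite [X in is_derive _ _ _ X]mxE; exact: is_derive_const.
by under eq_fun do rewrite exprS; exact: (mx_derive_mul (mx_derive_Lax x v)).
Qed.

(** Under the trace the noncommutative Leibniz sum collapses by cyclicity. *)
Lemma trace_dpow A B s m :
  \tr (A ^+ s *m dpow A B m.+1) = m.+1%:R * \tr (A ^+ (s + m) *m B).
Proof.
elim: m s => [|m IH] s.
  rewrite /= mulmx0 addr0 addn0 mul1r expr0; congr (\tr (_ *m _)); exact: mulmx1.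
rewrite [dpow _ _ _]/= -/(dpow A B m.+1) mulmxDr mxtraceD.
have -> : A ^+ s *m (A *m dpow A B m.+1) = A ^+ s.+1 *m dpow A B m.+1.
  by rewrite mulmxA exprSr.
rewrite IH mulmxA mxtrace_mulC mulmxA -[A ^+ _ *m A ^+ _]/(A ^+ _ * A ^+ _) -exprD.
have -> : (m.+1 + s = s.+1 + m)%N by lia.
by rewrite -[m.+2]add1n natrD mulrDl mul1r addSnnS.
Qed.

(** The commutator with [K] and the rule [A ^+ m |-> m A ^+ (m + n)] are both
    derivations on the powers of [A], hence so is their sum. *)
Lemma dpow_Lax A K n m :
  dpow A (K *m A - A *m K + A ^+ n.+1) m =
  K *m A ^+ m - A ^+ m *m K + m%:R *: A ^+ (m + n).
Proof.
elim: m => [|m IH] /=.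
  rewrite expr0 scale0r addr0.
  by apply/esym/eqP; rewrite subr_eq0; apply/eqP; rewrite [LHS]mulmx1 [RHS]mul1mx.
rewrite {}IH !mulmxDr !mulmxDl !mulmxN !mulNmx !mulmxA -!scalemxAr.
rewrite -![A *m A ^+ _]/(A * A ^+ _) -!exprS.
rewrite -[K *m A *m A ^+ m]mulmxA -[A *m A ^+ m]/(A * A ^+ m) -exprS.
rewrite -[A ^+ n.+1 *m _]/(A ^+ n.+1 * _) -exprD.
have -> : (n.+1 + m = (m + n).+1)%N by lia.
rewrite addSn -[m.+1]add1n natrD scalerDl scale1r.
set a := K *m _; set b := A *m K *m _; set c := _ *m K; set d := A ^+ _.
rewrite -!addrA; congr (_ + _); rewrite !addrA.
rewrite [- b + d]addrC -!addrA addKr.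
by rewrite addrCA.
Qed.

End PowerDerivatives.

(** * Trace Hamiltonians and Toda flows *)

Section TodaFlows.
Variables (R : realType) (N : nat).
Local Notation phase := 'rV[R]_(N.-1 + N).
Implicit Types (x v : phase) (S K : 'M[R]_N).

Definition trace_hamiltonian m : phase -> R :=
  fun x => \tr (Lax x ^+ m.+1) / m.+1%:R.

Lemma is_derive_trace_hamiltonian m x v :
  is_derive x v (trace_hamiltonian m) (\tr (Lax x ^+ m *m Lax v)).
Proof.
rewrite /trace_hamiltonian; apply: is_derive_eq.
  by apply: is_derive_mul; apply: is_derive_trace; exact: mx_derive_pow.
rewrite mulr0 addr0 -[dpow _ _ _]mul1mx -[1%:M]/(Lax x ^+ 0).
by rewrite trace_dpow add0n mulrC mulrA mulVf ?mul1r // pnatr_eq0.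
Qed.

(** The components of [pi_1 df] when [df] is [v |-> tr (S dL(v))] with [S]
    symmetric. *)
Definition flow_a x S i : R := fl_a x i * (entry1 S i.+1 i.+1 - entry1 S i i).
Definition flow_b x S i : R :=
  2 * fl_a x i * entry1 S i i.+1 - 2 * fl_a x i.-1 * entry1 S i.-1 i.

Definition toda_flow (S : phase -> 'M[R]_N) : vector_field R (N.-1 + N) :=
  mk_vector_field (fun x => flow_a x (S x)) (fun x => flow_b x (S x)).

Lemma flow_a_supported x S : supported N.-1 (flow_a x S).
Proof. by move=> i Ni; rewrite /flow_a fl_a_supported ?mul0r. Qed.

Lemma flow_b_supported x S : supported N (flow_b x S).
Proof.
move=> i Ni; rewrite /flow_b (fl_a_supported x (i := i)); last by lia.
by rewrite (fl_a_supported x (i := i.-1)); [ring|lia].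
Qed.

Lemma sum_if_pick m (G u w : nat -> R) i : supported m G ->
  \sum_(k < m) (if k.+1 == i then u k.+1
                else if k.+1 == i.+1 then w k.+1 else 0) * G k.+1 =
  u i * G i + w i.+1 * G i.+1.
Proof.
move=> h; have hc c : supported m (fun k => c k * G k).
  by move=> k km; rewrite h ?mulr0.
rewrite -(sum_pick i (hc u)) -(sum_pick i.+1 (hc w)) -big_split /=.
apply: eq_bigr => k _; case: eqP => [->|_].
  by rewrite ltn_eqF // mul0r addr0 mul1r.
by case: eqP => _; rewrite !mul0r add0r ?mul1r.
Qed.

Lemma sum_if_pick_around m (G u w : nat -> R) i : supported m G ->
  \sum_(k < m) (if k.+1 == i.+1 then u k.+1
                else if i == k.+2 then w k.+1 else 0) * G k.+1 =
  u i.+1 * G i.+1 + w i.-1 * G i.-1.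
Proof.
move=> h; have hc c : supported m (fun k => c k * G k).
  by move=> k km; rewrite h ?mulr0.
rewrite -(sum_pick i.+1 (hc u)) -subn1 -(sum_pick_pred i 1 (hc w)) -big_split /=.
apply: eq_bigr => k _; rewrite addn1; case: (k.+1 =P i.+1) => [[<-]|_].
  by rewrite ltn_eqF ?mul0r ?addr0 ?mul1r //; lia.
by case: eqP => _; rewrite !mul0r add0r ?mul1r.
Qed.

Lemma sum_if_pick_pred m (G u w : nat -> R) i : supported m G ->
  \sum_(k < m) (if i == k.+1 then u k.+1
                else if i == k.+2 then w k.+1 else 0) * G k.+1 =
  u i * G i + w i.-1 * G i.-1.
Proof.
move=> h; have hc c : supported m (fun k => c k * G k).
  by move=> k km; rewrite h ?mulr0.
rewrite -(sum_pick i (hc u)) -subn1 -(sum_pick_pred i 1 (hc w)) -big_split /=.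
apply: eq_bigr => k _; rewrite addn1 [_.+1 == i]eq_sym; case: eqP => [->|_].
  by rewrite ltn_eqF // mul0r addr0 mul1r.
by case: eqP => _; rewrite !mul0r add0r ?mul1r.
Qed.

Lemma fl_a_delta_lshift (j : 'I_N.-1) i :
  fl_a (delta_mx 0 (lshift N j) : phase) i = (i == j.+1)%:R.
Proof.
rewrite /fl_a -(coord1_row (m := N.-1) (G := fun i => (i == j.+1)%:R)).
  by congr coord1; apply/rowP => k; rewrite !mxE /= eq_lshift.
by move=> k Nk; case: eqP => // E; case/negP: Nk; rewrite E /= ltn_ord.
Qed.

Lemma coord1_0 m i : coord1 (0 : 'rV[R]_m) i = 0.
Proof. by case: i => [|k] //=; case: insub => //= ?; rewrite mxE. Qed.

Lemma fl_b_delta_lshift (j : 'I_N.-1) i :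
  fl_b (delta_mx 0 (lshift N j) : phase) i = 0.
Proof.
rewrite /fl_b (_ : rsubmx _ = 0) ?coord1_0 //.
by apply/rowP => k; rewrite !mxE /= eq_rlshift.
Qed.

Lemma fl_a_delta_rshift (j : 'I_N) i :
  fl_a (delta_mx 0 (rshift N.-1 j) : phase) i = 0.
Proof.
rewrite /fl_a (_ : lsubmx _ = 0) ?coord1_0 //.
by apply/rowP => k; rewrite !mxE /= eq_lrshift.
Qed.

Lemma fl_b_delta_rshift (j : 'I_N) i :
  fl_b (delta_mx 0 (rshift N.-1 j) : phase) i = (i == j.+1)%:R.
Proof.
rewrite /fl_b -(coord1_row (m := N) (G := fun i => (i == j.+1)%:R)).
  by congr coord1; apply/rowP => k; rewrite !mxE /= eq_rshift.
by move=> k Nk; case: eqP => // E; case/negP: Nk; rewrite E /= ltn_ord.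
Qed.

Lemma trace_mul_Lax_delta_a S (j : 'I_N.-1) : S^T = S ->
  \tr (S *m Lax (delta_mx 0 (lshift N j))) = 2 * entry1 S j.+1 j.+2.
Proof.
move=> sS; rewrite mxtrace_entry1.
under eq_bigr do rewrite entry1_mul_Lax !fl_a_delta_lshift fl_b_delta_lshift
  mulr0 addr0 ![entry1 _ _ _ * _]mulrC /=.
rewrite big_split /=.
have h1 : supported N (fun k => entry1 S k k.-1).
  by move=> k Nk; exact: entry1_supported_row.
have h2 : supported N (fun k => entry1 S k k.+1).
  by move=> k Nk; exact: entry1_supported_row.
rewrite (sum_pick j.+1 h2).
rewrite -[X in X + _ = _]/(\sum_(k < N) (k.+1 == j.+2)%:R
                                        * entry1 S k.+1 k.+1.-1).
by rewrite (sum_pick j.+2 h1) /= entry1_sym //; ring.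
Qed.

Lemma trace_mul_Lax_delta_b S (j : 'I_N) :
  \tr (S *m Lax (delta_mx 0 (rshift N.-1 j))) = entry1 S j.+1 j.+1.
Proof.
rewrite mxtrace_entry1.
under eq_bigr do rewrite entry1_mul_Lax !fl_a_delta_rshift fl_b_delta_rshift
  !mulr0 addr0 add0r mulrC.
have h : supported N (fun k => entry1 S k k).
  by move=> k Nk; exact: entry1_supported_row.
exact: (sum_pick j.+1 h).
Qed.

(** The differential of [f] at [x] is represented by the matrix [S] through the
    trace form; [Lax] is linear, so [Lax (delta_mx 0 k)] is its [k]-th partial
    derivative. *)
Definition has_gradient (f : phase -> R) x S :=
  forall k, partial k f x = \tr (S *m Lax (delta_mx 0 k)).

Lemma trace_hamiltonian_gradient m x :
  has_gradient (trace_hamiltonian m) x (Lax x ^+ m).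
Proof.
by move=> k; apply: is_derive_partial; exact: is_derive_trace_hamiltonian.
Qed.

Lemma hamiltonian_mk Paa Pab Pbb f x S : S^T = S -> has_gradient f x S ->
  hamiltonian (@mk_bivector_field R N Paa Pab Pbb) f x =
  row_mx
   (\row_i (\sum_(j < N.-1) Paa x i.+1 j.+1 * (2 * entry1 S j.+1 j.+2)
           + \sum_(j < N) Pab x i.+1 j.+1 * entry1 S j.+1 j.+1))
   (\row_i (\sum_(j < N.-1) - Pab x j.+1 i.+1 * (2 * entry1 S j.+1 j.+2)
           + \sum_(j < N) Pbb x i.+1 j.+1 * entry1 S j.+1 j.+1)).
Proof.
move=> sS hf; apply/rowP => k; rewrite !mxE big_split_ord /=.
under eq_bigr do rewrite hf trace_mul_Lax_delta_a //.
under [X in _ + X]eq_bigr do rewrite hf trace_mul_Lax_delta_b //.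
case: (split_ordP k) => [i|i] ->; rewrite ?mxE.
  congr (_ + _); apply: eq_bigr => j _.
    by rewrite /mk_bivector_field block_mxEul mxE.
  by rewrite /mk_bivector_field block_mxEur mxE.
congr (_ + _); apply: eq_bigr => j _.
  by rewrite /mk_bivector_field block_mxEdl mxE.
by rewrite /mk_bivector_field block_mxEdr mxE.
Qed.

Lemma super_diagonal_supported S : supported N.-1 (fun k => 2 * entry1 S k k.+1).
Proof.
case=> [|k] Nk; first by rewrite entry1_0 mulr0.
by rewrite entry1_supported_col ?mulr0 //; lia.
Qed.

Lemma diagonal_supported S : supported N (fun k => entry1 S k k).
Proof. by move=> k Nk; exact: entry1_supported_row. Qed.

Lemma hamiltonian_pi1 f x S : S^T = S -> has_gradient f x S ->
  hamiltonian (@toda_pi1 R N) f x = toda_flow (fun=> S) x.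
Proof.
move=> sS hf; rewrite (hamiltonian_mk _ _ _ sS hf).
congr row_mx; apply/rowP => i; rewrite !mxE.
  rewrite big1 ?add0r => [|j _]; last by rewrite mul0r.
  rewrite (sum_if_pick (fun=> - fl_a x i.+1) (fun=> fl_a x i.+1) i.+1
    (@diagonal_supported S)).
  by rewrite /flow_a; ring.
rewrite [X in _ + X]big1 ?addr0 => [|j _]; last by rewrite mul0r.
under eq_bigr do rewrite mulNr.
rewrite sumrN (sum_if_pick_pred (fun j => - fl_a x j) (fl_a x) i.+1
  (@super_diagonal_supported S)).
by rewrite /flow_b /=; ring.
Qed.

(** The first link of the Lenard chain, for any symmetric [S] commuting with [L].
    In the [b] components the entries of [L S] and of [S L] are used at
    neighbouring places, so that the entries of [S] two steps away from the
    diagonal cancel. *)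
Lemma hamiltonian_pi2 f x S : S^T = S -> Lax x *m S = S *m Lax x ->
  has_gradient f x S ->
  hamiltonian (@toda_pi2 R N) f x = toda_flow (fun y => Lax y *m S) x.
Proof.
move=> sS cS hf; rewrite (hamiltonian_mk _ _ _ sS hf).
congr row_mx; apply/rowP => i; rewrite !mxE.
  rewrite (sum_if_pick (fun=> - (fl_a x i.+1 * fl_b x i.+1))
    (fun j => fl_a x i.+1 * fl_b x j) i.+1 (@diagonal_supported S)).
  rewrite (sum_if_pick_around (fun j => 2^-1 * (fl_a x i.+1 * fl_a x j))
    (fun j => - (2^-1 * (fl_a x j * fl_a x i.+1))) i.+1
    (@super_diagonal_supported S)).
  rewrite /flow_a !entry1_Lax_mul /=.
  rewrite (entry1_sym i.+3 i.+2) // (entry1_sym i.+2 i.+1) //.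
  by field.
under eq_bigr do rewrite mulNr.
rewrite sumrN (sum_if_pick_pred (fun j => - (fl_a x j * fl_b x j))
  (fun j => fl_a x j * fl_b x i.+1) i.+1 (@super_diagonal_supported S)).
rewrite (sum_if_pick_around (fun=> 2 * fl_a x i.+1 ^+ 2)
  (fun j => - (2 * fl_a x j ^+ 2)) i.+1 (@diagonal_supported S)).
rewrite /flow_b entry1_Lax_mul cS entry1_mul_Lax /=.
by ring.
Qed.

End TodaFlows.

(** * Polynomiality *)

Section Polynomiality.
Variables (R : realType) (N : nat).
Local Notation phase := 'rV[R]_(N.-1 + N).

Lemma polyfun_fl_a i : polyfun (fun x : phase => fl_a x i).
Proof.
case: (boolP (0 < i <= N.-1)%N) => [/in_rangeP[k ->]|Ni].
  under eq_fun do rewrite /fl_a coord1_ord mxE; exact: polyfun_coord.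
under eq_fun do rewrite fl_a_supported //; exact: polyfun_const.
Qed.

Lemma polyfun_fl_b i : polyfun (fun x : phase => fl_b x i).
Proof.
case: (boolP (0 < i <= N)%N) => [/in_rangeP[k ->]|Ni].
  under eq_fun do rewrite /fl_b coord1_ord mxE; exact: polyfun_coord.
under eq_fun do rewrite fl_b_supported //; exact: polyfun_const.
Qed.

Lemma polyfun_if (c : bool) (f g : phase -> R) : polyfun f -> polyfun g ->
  polyfun (fun x => if c then f x else g x).
Proof. by case: c. Qed.

Ltac polyfun_tac := repeat first
  [ exact: polyfun_fl_a | exact: polyfun_fl_b | exact: polyfun_const
  | apply: polyfun_if | apply: polyfun_sum => ? | apply: polyfun_exp
  | apply: polyfun_opp | apply: polyfun_add | apply: polyfun_mul ].

Lemma polyfun_Lax i j : polyfun (fun x : phase => Lax x i j).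
Proof.
under eq_fun do rewrite -entry1_ord entry1_Lax; by polyfun_tac.
Qed.

Lemma polyfun_Lax_pow m i j : polyfun (fun x : phase => (Lax x ^+ m) i j).
Proof.
elim: m i j => [|m IH] i j; first exact: polyfun_const.
under eq_fun do rewrite exprS mxE.
by apply: polyfun_sum => k; apply: polyfun_mul => //; exact: polyfun_Lax.
Qed.

Lemma polyfun_entry1 (A : phase -> 'M[R]_N) i j :
  (forall k l, polyfun (fun x => A x k l)) -> polyfun (fun x => entry1 (A x) i j).
Proof.
move=> h; case: (boolP (0 < i <= N)%N) => [/in_rangeP[k ->]|Ni]; last first.
  under eq_fun do rewrite entry1_supported_row //; exact: polyfun_const.
case: (boolP (0 < j <= N)%N) => [/in_rangeP[l ->]|Nj]; last first.
  under eq_fun do rewrite entry1_supported_col //; exact: polyfun_const.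
under eq_fun do rewrite entry1_ord; exact: h.
Qed.

Lemma polyfun_trace_hamiltonian m : polyfun (@trace_hamiltonian R N m).
Proof.
apply: polyfun_mul; last exact: polyfun_const.
by apply: polyfun_sum => i; exact: polyfun_Lax_pow.
Qed.

Lemma poly_mk_vector_field (Ca Cb : phase -> nat -> R) :
  (forall i, polyfun (Ca ^~ i)) -> (forall i, polyfun (Cb ^~ i)) ->
  poly_vector_field (mk_vector_field Ca Cb).
Proof.
move=> ha hb k; rewrite /mk_vector_field; case: (split_ordP k) => i ->.
  by under eq_fun do rewrite row_mxEl mxE; exact: ha.
by under eq_fun do rewrite row_mxEr mxE; exact: hb.
Qed.

Lemma poly_mk_bivector_field (Paa Pab Pbb : phase -> nat -> nat -> R) :
  (forall i j, polyfun (fun x => Paa x i j)) ->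
  (forall i j, polyfun (fun x => Pab x i j)) ->
  (forall i j, polyfun (fun x => Pbb x i j)) ->
  poly_bivector_field (mk_bivector_field Paa Pab Pbb).
Proof.
move=> haa hab hbb k l; rewrite /mk_bivector_field.
case: (split_ordP k) => i ->; case: (split_ordP l) => j ->.
- by under eq_fun do rewrite block_mxEul mxE; exact: haa.
- by under eq_fun do rewrite block_mxEur mxE; exact: hab.
- by under eq_fun do rewrite block_mxEdl mxE; apply: polyfun_opp; exact: hab.
- by under eq_fun do rewrite block_mxEdr mxE; exact: hbb.
Qed.

Lemma polyfun_master_A i : polyfun (fun x : phase => master_A x i).
Proof. by rewrite /master_A; polyfun_tac. Qed.
Lemma polyfun_master_B i : polyfun (fun x : phase => master_B x i).
Proof. by rewrite /master_B; polyfun_tac. Qed.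
Lemma polyfun_master_C i : polyfun (fun x : phase => master_C x i).
Proof. by rewrite /master_C; polyfun_tac. Qed.
Lemma polyfun_master_D i : polyfun (fun x : phase => master_D x i).
Proof. by rewrite /master_D; polyfun_tac. Qed.

Lemma poly_pi1 : poly_bivector_field (@toda_pi1 R N).
Proof.
by apply: poly_mk_bivector_field => i j /=; polyfun_tac.
Qed.

Lemma poly_pi2 : poly_bivector_field (@toda_pi2 R N).
Proof.
by apply: poly_mk_bivector_field => i j /=; polyfun_tac.
Qed.

Lemma poly_master_X1 : poly_vector_field (@master_X1 R N).
Proof.
by apply: poly_mk_vector_field => i; [exact: polyfun_master_A|exact: polyfun_master_B].
Qed.

Lemma poly_master_X2 : poly_vector_field (@master_X2 R N).
Proof.
by apply: poly_mk_vector_field => i; [exact: polyfun_master_C|exact: polyfun_master_D].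
Qed.

Lemma polyfun_flow_a m i : polyfun (fun x : phase => flow_a x (Lax x ^+ m) i).
Proof.
apply: polyfun_mul; first exact: polyfun_fl_a.
by apply: polyfun_add; [|apply: polyfun_opp];
   apply: polyfun_entry1 => k l; exact: polyfun_Lax_pow.
Qed.

Lemma polyfun_flow_b m i : polyfun (fun x : phase => flow_b x (Lax x ^+ m) i).
Proof.
have pS j k : polyfun (fun x : phase => entry1 (Lax x ^+ m) j k).
  by apply: polyfun_entry1 => ? ?; exact: polyfun_Lax_pow.
rewrite /flow_b; apply: polyfun_add; last apply: polyfun_opp.
  by apply: polyfun_mul; [polyfun_tac|exact: pS].
by apply: polyfun_mul; [polyfun_tac|exact: pS].
Qed.

End Polynomiality.

(** * Master symmetries shift the Toda flows *)

Section Brackets.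
Variables (R : realType) (N : nat).
Local Notation phase := 'rV[R]_(N.-1 + N).
Implicit Types (x v : phase) (S K : 'M[R]_N).

Definition power_flow m := toda_flow (fun x : phase => Lax x ^+ m).

Ltac is_derive_tac := repeat first
  [ exact: is_derive_fl_a | exact: is_derive_fl_b | exact: is_derive_const
  | apply: is_derive_bigsum => ?
  | apply: is_derive_exp | apply: is_derive_opp
  | apply: is_derive_add | apply: is_derive_mul ].

Lemma is_derive_master_A x v i :
  let a := fl_a x in let b := fl_b x in let a' := fl_a v in let b' := fl_b v in
  is_derive x v (fun y => master_A y i)
    (- i%:R * (a' i * b i + a i * b' i)
     + (i%:R + 2) * (a' i * b i.+1 + a i * b' i.+1)).
Proof.
move=> a b a' b'; rewrite /master_A; apply: is_derive_eq.
  by is_derive_tac.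
by rewrite /= -/a -/b -/a' -/b'; ring.
Qed.

Lemma is_derive_master_B x v i :
  let a := fl_a x in let b := fl_b x in let a' := fl_a v in let b' := fl_b v in
  is_derive x v (fun y => master_B y i)
    ((2 * i%:R + 3) * (2 * a i * a' i)
     + (1 - 2 * i%:R) * (2 * a i.-1 * a' i.-1) + 2 * b i * b' i).
Proof.
move=> a b a' b'; rewrite /master_B; apply: is_derive_eq.
  by is_derive_tac.
by rewrite /= -/a -/b -/a' -/b'; ring.
Qed.

Lemma is_derive_master_C x v i :
  let a := fl_a x in let b := fl_b x in let a' := fl_a v in let b' := fl_b v in
  is_derive x v (fun y => master_C y i)
    ((2 - i%:R) * (2 * a i.-1 * a' i.-1 * a i + a i.-1 ^+ 2 * a' i)
     + (1 - i%:R) * (a' i * b i ^+ 2 + 2 * a i * b i * b' i)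
     + (a' i * b i * b i.+1 + a i * b' i * b i.+1 + a i * b i * b' i.+1)
     + (i%:R + 1) * (a' i * a i.+1 ^+ 2 + 2 * a i * a i.+1 * a' i.+1)
     + (i%:R + 1) * (a' i * b i.+1 ^+ 2 + 2 * a i * b i.+1 * b' i.+1)
     + 3 * a i ^+ 2 * a' i
     + (sumb v i * a i + sumb x i * a' i) * (b i.+1 - b i)
     + sumb x i * a i * (b' i.+1 - b' i)).
Proof.
move=> a b a' b'; rewrite /master_C; apply: is_derive_eq.
  by is_derive_tac.
by rewrite /= -!/(sumb _ _) -/a -/b -/a' -/b'; ring.
Qed.

Lemma is_derive_master_D x v i :
  let a := fl_a x in let b := fl_b x in let a' := fl_a v in let b' := fl_b v in
  is_derive x v (fun y => master_D y i)
    (2 * (sumb v i * a i ^+ 2 + 2 * sumb x i * a i * a' i)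
     - 2 * (sumb v i.-1 * a i.-1 ^+ 2 + 2 * sumb x i.-1 * a i.-1 * a' i.-1)
     + (2 * i%:R + 2) * (2 * a i * a' i * b i + a i ^+ 2 * b' i)
     + (2 * i%:R + 1) * (2 * a i * a' i * b i.+1 + a i ^+ 2 * b' i.+1)
     + (3 - 2 * i%:R) * (2 * a i.-1 * a' i.-1 * b i.-1 + a i.-1 ^+ 2 * b' i.-1)
     + (4 - 2 * i%:R) * (2 * a i.-1 * a' i.-1 * b i + a i.-1 ^+ 2 * b' i)
     + 3 * b i ^+ 2 * b' i).
Proof.
move=> a b a' b'; rewrite /master_D; apply: is_derive_eq.
  by is_derive_tac.
by rewrite /= -!/(sumb _ _) -/a -/b -/a' -/b'; ring.
Qed.

Lemma entry1_commutator_diag q p S i : S^T = S ->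
  supported N.-1 q -> supported N.-2 p ->
  entry1 (skew_band N q p *m S - S *m skew_band N q p) i i =
  2 * (q i * entry1 S i i.+1 + p i * entry1 S i i.+2
       - q (i - 1)%N * entry1 S (i - 1) i - p (i - 2)%N * entry1 S (i - 2) i).
Proof.
move=> sS hq hp; rewrite entry1_commutator //.
rewrite (entry1_sym i.+1) // (entry1_sym i.+2) // (entry1_sym i (i - 1)) //.
by rewrite (entry1_sym i (i - 2)) //; ring.
Qed.

Lemma entry1_commutator_up q p S i : S^T = S ->
  supported N.-1 q -> supported N.-2 p ->
  entry1 (skew_band N q p *m S - S *m skew_band N q p) i i.+1 =
  q i * (entry1 S i.+1 i.+1 - entry1 S i i)
  + p i * entry1 S i.+1 i.+2 - p (i - 1)%N * entry1 S (i - 1) i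
  + q i.+1 * entry1 S i i.+2 - q (i - 1)%N * entry1 S (i - 1) i.+1
  + p i.+1 * entry1 S i i.+3 - p (i - 2)%N * entry1 S (i - 2) i.+1.
Proof.
move=> sS hq hp; rewrite entry1_commutator // !subSS subn0.
rewrite (entry1_sym i.+2 i.+1) // (entry1_sym i (i - 1)) //.
by ring.
Qed.

(** For a field [X] with [X L = [K, L] + L^(n+1)], differentiating the coefficient
    [L^m] of the flow produces [m L^(m+n)], the expected answer, and a commutator
    with [K].  The bracket relation thus reduces to two identities per site,
    in which [dK] stands for that commutator. *)
Section Shift.
Variables (Ca Cb : phase -> nat -> R) (n : nat) (K : 'M[R]_N) (x : phase).
Let X := mk_vector_field Ca Cb.
Hypothesis Ca_supported : forall y, supported N.-1 (Ca y).
Hypothesis poly_X : poly_vector_field X.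
Hypothesis Lax_X : Lax (X x) = K *m Lax x - Lax x *m K + Lax x ^+ n.+1.

Lemma mx_derive_pow_master m :
  mx_derive x (X x) (fun y => Lax y ^+ m)
    (K *m Lax x ^+ m - Lax x ^+ m *m K + m%:R *: Lax x ^+ (m + n)).
Proof. by rewrite -dpow_Lax -Lax_X; exact: mx_derive_pow. Qed.

Lemma dir_trace_hamiltonian m :
  dir X (@trace_hamiltonian R N m) x =
  (m + n).+1%:R * trace_hamiltonian (m + n) x.
Proof.
rewrite (dir_is_derive (is_derive_trace_hamiltonian m x (X x))); last first.
  exact: polyfun_trace_hamiltonian.
have tc : \tr (Lax x ^+ m *m (K *m Lax x)) = \tr (Lax x ^+ m *m (Lax x *m K)).
  rewrite mulmxA mxtrace_mulC !mulmxA.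
  rewrite -[Lax x *m _]/(Lax x * Lax x ^+ m) -[_ *m Lax x]/(Lax x ^+ m * Lax x).
  by rewrite -exprS -exprSr.
rewrite Lax_X mulmxDr mulmxBr linearD /= linearB /= tc subrr add0r.
rewrite -[_ *m _]/(_ * _) -exprD addnS /trace_hamiltonian mulrC divfK //.
by rewrite pnatr_eq0.
Qed.

Lemma dir_flow_a m i :
  let S := Lax x ^+ m in let dK := K *m S - S *m K in
  dir X (fun y => flow_a y (Lax y ^+ m) i) x =
  Ca x i * (entry1 S i.+1 i.+1 - entry1 S i i)
  + fl_a x i * (entry1 dK i.+1 i.+1 - entry1 dK i i)
  + m%:R * flow_a x (Lax x ^+ (m + n)) i.
Proof.
move=> S dK; have h j k := is_derive_entry1 j k (mx_derive_pow_master m).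
apply: dir_is_derive; last exact: polyfun_flow_a.
rewrite /flow_a; apply: is_derive_eq.
  exact: is_derive_mul (is_derive_fl_a _ _ _)
    (is_derive_add (h _ _) (is_derive_opp (h _ _))).
rewrite /X fl_a_mk // -/S -/dK !entry1D !entry1Z; ring.
Qed.

Lemma dir_flow_b m i :
  let S := Lax x ^+ m in let dK := K *m S - S *m K in
  dir X (fun y => flow_b y (Lax y ^+ m) i) x =
  2 * (Ca x i * entry1 S i i.+1 + fl_a x i * entry1 dK i i.+1)
  - 2 * (Ca x i.-1 * entry1 S i.-1 i + fl_a x i.-1 * entry1 dK i.-1 i)
  + m%:R * flow_b x (Lax x ^+ (m + n)) i.
Proof.
move=> S dK; have h j k := is_derive_entry1 j k (mx_derive_pow_master m).
apply: dir_is_derive; last exact: polyfun_flow_b.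
rewrite /flow_b; apply: is_derive_eq.
  have ha j := is_derive_mul (is_derive_const x (X x) 2) (is_derive_fl_a x (X x) j).
  exact: is_derive_add (is_derive_mul (ha _) (h _ _))
    (is_derive_opp (is_derive_mul (ha _) (h _ _))).
rewrite /X !fl_a_mk // -/S -/dK !entry1D !entry1Z; ring.
Qed.

Lemma bracket_power_flow m :
  let S := Lax x ^+ m in let dK := K *m S - S *m K in
  (forall i, is_derive x (power_flow m x) (Ca ^~ i.+1)
    (Ca x i.+1 * (entry1 S i.+2 i.+2 - entry1 S i.+1 i.+1)
     + fl_a x i.+1 * (entry1 dK i.+2 i.+2 - entry1 dK i.+1 i.+1))) ->
  (forall i, is_derive x (power_flow m x) (Cb ^~ i.+1)
    (2 * (Ca x i.+1 * entry1 S i.+1 i.+2 + fl_a x i.+1 * entry1 dK i.+1 i.+2)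
     - 2 * (Ca x i * entry1 S i i.+1 + fl_a x i * entry1 dK i i.+1))) ->
  bracket X (power_flow m) x = m%:R *: power_flow (m + n) x.
Proof.
move=> S dK ha hb; apply/rowP => k; rewrite !mxE.
case: (split_ordP k) => i -> {k}; rewrite /power_flow /toda_flow /X /mk_vector_field.
  rewrite [X in _ - X](_ : _ = dir (power_flow m) (Ca ^~ i.+1) x); last first.
    by congr dir; apply/funext => y; rewrite row_mxEl mxE.
  rewrite (_ : (fun y => _) = fun y => flow_a y (Lax y ^+ m) i.+1); last first.
    by apply/funext => y; rewrite row_mxEl mxE.
  rewrite dir_flow_a (dir_is_derive (ha i)).
    by rewrite mxE -/S -/dK; ring.
  have := poly_X (lshift N i); rewrite /X /mk_vector_field.
  by under eq_fun do rewrite row_mxEl mxE.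
rewrite [X in _ - X](_ : _ = dir (power_flow m) (Cb ^~ i.+1) x); last first.
  by congr dir; apply/funext => y; rewrite row_mxEr mxE.
rewrite (_ : (fun y => _) = fun y => flow_b y (Lax y ^+ m) i.+1); last first.
  by apply/funext => y; rewrite row_mxEr mxE.
rewrite dir_flow_b (dir_is_derive (hb i)).
  by rewrite mxE -/S -/dK; ring.
have := poly_X (rshift N.-1 i); rewrite /X /mk_vector_field.
by under eq_fun do rewrite row_mxEr mxE.
Qed.

End Shift.

Lemma fl_a_power_flow m x i : fl_a (power_flow m x) i = flow_a x (Lax x ^+ m) i.
Proof. by rewrite fl_a_mk //; exact: flow_a_supported. Qed.

Lemma fl_b_power_flow m x i : fl_b (power_flow m x) i = flow_b x (Lax x ^+ m) i.
Proof. by rewrite fl_b_mk //; exact: flow_b_supported. Qed.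

(** The flow of [b_k] is a difference, so its partial sums telescope. *)
Lemma sumb_power_flow m x i :
  sumb (power_flow m x) i.+1 = 2 * fl_a x i * entry1 (Lax x ^+ m) i i.+1.
Proof.
elim: i => [|i IH]; first by rewrite sumb1 fl_a0; ring.
by rewrite sumbS IH fl_b_power_flow /flow_b /=; ring.
Qed.

(** The entries of [[L, S]] on the first and second superdiagonals.  Their
    vanishing is all that the bracket computations use about [S = L^m] besides
    symmetry. *)
Definition commutator_up1 x S i := fl_a x i.-1 * entry1 S i.-1 i.+1
  + fl_b x i * entry1 S i i.+1 + fl_a x i * entry1 S i.+1 i.+1
  - (entry1 S i i * fl_a x i + entry1 S i i.+1 * fl_b x i.+1
     + entry1 S i i.+2 * fl_a x i.+1).

Definition commutator_up2 x S i := fl_a x i.-1 * entry1 S i.-1 i.+2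
  + fl_b x i * entry1 S i i.+2 + fl_a x i * entry1 S i.+1 i.+2
  - (entry1 S i i.+1 * fl_a x i.+1 + entry1 S i i.+2 * fl_b x i.+2
     + entry1 S i i.+3 * fl_a x i.+2).

Lemma commutator_up1_eq0 x S i : Lax x *m S = S *m Lax x -> commutator_up1 x S i = 0.
Proof.
by rewrite /commutator_up1 => h; rewrite -entry1_Lax_mul h entry1_mul_Lax subrr.
Qed.

Lemma commutator_up2_eq0 x S i : Lax x *m S = S *m Lax x -> commutator_up2 x S i = 0.
Proof.
by rewrite /commutator_up2 => h; rewrite -entry1_Lax_mul h entry1_mul_Lax subrr.
Qed.

Lemma Lax_pow_comm x m : Lax x *m Lax x ^+ m = Lax x ^+ m *m Lax x.
Proof. by rewrite -[LHS]/(Lax x * Lax x ^+ m) -exprS exprSr. Qed.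

(** In the [a] components the commutator term cancels identically.  The [b]
    components involve the second superdiagonal of [S], which enters only through
    differences that [commutator_up1] expresses by entries closer to the
    diagonal. *)
Lemma bracket_master_X1 m x :
  bracket (@master_X1 R N) (power_flow m) x = m%:R *: power_flow m.+1 x.
Proof.
have [hq hp] := (@lax_q1_supported R N x, @zero_supported R N.-2).
have sS := pow_tr m (Lax_tr x).
have r i := commutator_up1_eq0 i (Lax_pow_comm x m).
rewrite -[m.+1]addn1; apply: (bracket_power_flow (Ca := @master_A R N)
  (Cb := @master_B R N) (n := 1) (K := lax_part1 x)).
- exact: master_A_supported.
- exact: poly_master_X1.
- exact: Lax_master_X1.
- move=> i; apply: is_derive_eq; first exact: is_derive_master_A.
  rewrite !fl_a_power_flow !fl_b_power_flow !entry1_commutator_diag //.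
  rewrite /flow_a /flow_b.
  rewrite /master_A /lax_q1 !subSS !subn0 /=.
  by ring.
- move=> i; apply: is_derive_eq; first exact: is_derive_master_B.
  rewrite !fl_a_power_flow !fl_b_power_flow /flow_a /flow_b.
  rewrite (entry1_commutator_up _ sS hq hp) (entry1_commutator_up i sS hq hp).
  set S := Lax x ^+ m in r sS *.
  apply/eqP; rewrite -subr_eq0; apply/eqP.
  transitivity (2 * (i.+1%:R + 2) * fl_a x i.+1 * commutator_up1 x S i.+1
    - 2 * i%:R * fl_a x i * commutator_up1 x S i); last by rewrite !r; ring.
  rewrite /commutator_up1 /master_A /master_B /lax_q1 !subSS !subn0 /=.
  case: i => [|i]; rewrite ?(subSS, subn0) /= ?fl_a0 ?fl_b0 ?entry1_0; ring.
Qed.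

(** Same pattern with one more diagonal.  Put
    [W_i = a_i a_(i+1) S_(i,i+2)] and [Z_i = a_i a_(i+1) a_(i+2) S_(i,i+3)].
    Then [a_i] times [commutator_up1] at [i] is [W_(i-1) - W_i] plus terms nearer
    to the diagonal, and [a_i a_(i+1)] times [commutator_up2] at [i] is
    [Z_(i-1) - Z_i] plus terms in [W] and nearer ones.  The coefficients of the
    [Z], and after their removal those of the [W], sum to zero, which determines
    the multipliers in the proof one after the other. *)
Lemma bracket_master_X2 m x :
  bracket (@master_X2 R N) (power_flow m) x = m%:R *: power_flow m.+2 x.
Proof.
have [hq hp] := (@lax_q2_supported R N x, @lax_p2_supported R N x).
have sS := pow_tr m (Lax_tr x).
have r i := commutator_up1_eq0 i (Lax_pow_comm x m).
have t i := commutator_up2_eq0 i (Lax_pow_comm x m).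
rewrite -[m.+2]addn2; apply: (bracket_power_flow (Ca := @master_C R N)
  (Cb := @master_D R N) (n := 2) (K := lax_part2 x)).
- exact: master_C_supported.
- exact: poly_master_X2.
- exact: Lax_master_X2.
- move=> i; apply: is_derive_eq; first exact: is_derive_master_C.
  rewrite sumb_power_flow !fl_a_power_flow !fl_b_power_flow.
  rewrite !entry1_commutator_diag // /flow_a /flow_b.
  set S := Lax x ^+ m in r sS *.
  apply/eqP; rewrite -subr_eq0; apply/eqP.
  transitivity (fl_a x i.+1 *
    (2 * (i%:R + 2) * fl_a x i.+2 * commutator_up1 x S i.+2
     + 2 * fl_a x i.+1 * commutator_up1 x S i.+1
     - 2 * (i%:R - 1) * fl_a x i * commutator_up1 x S i));
    last by rewrite !r; ring.
  rewrite /commutator_up1 /master_C /lax_q2 /lax_p2 -!/(sumb _ _) !subSS !subn0 /=.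
  rewrite !sumbS.
  (* The first sites are separate because indices below 1 are truncated. *)
  case: i => [|[|i]]; rewrite ?(subSS, subn0) /= ?sumbS ?fl_a0 ?fl_b0;
    rewrite ?entry1_0 ?sumb0; ring.
- move=> i; apply: is_derive_eq; first exact: is_derive_master_D.
  rewrite sumb_power_flow !fl_a_power_flow !fl_b_power_flow.
  rewrite (entry1_commutator_up _ sS hq hp) (entry1_commutator_up i sS hq hp).
  rewrite /flow_a /flow_b.
  set S := Lax x ^+ m in r t sS *.
  apply/eqP; rewrite -subr_eq0; apply/eqP.
  transitivity (
    (2 * (i%:R + 2) * (fl_b x i.+1 + fl_b x i.+2) + 2 * sumb x i.+2)
      * fl_a x i.+1 * commutator_up1 x S i.+1
    - (2 * sumb x i + 2 * (i%:R - 1) * fl_b x i + 2 * (i%:R - 2) * fl_b x i.+1)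
      * fl_a x i * commutator_up1 x S i
    + 2 * (i%:R + 2) * fl_a x i.+1 * fl_a x i.+2 * commutator_up2 x S i.+1
    + 2 * fl_a x i * fl_a x i.+1 * commutator_up2 x S i
    - 2 * (i%:R - 2) * fl_a x i.-1 * fl_a x i * commutator_up2 x S i.-1);
    last by rewrite !r !t; ring.
  rewrite /commutator_up1 /commutator_up2 /master_C /master_D /lax_q2 /lax_p2.
  rewrite -!/(sumb _ _) !subSS !subn0 /=.
  case: i => [|[|[|i]]]; rewrite ?(subSS, subn0) /= ?sumb_power_flow ?sumbS;
    rewrite ?fl_a0 ?fl_b0 ?entry1_0 ?sumb0; ring.
Qed.

End Brackets.

(** * The hierarchy acts on trace Hamiltonians by Toda flows *)

Section Hierarchy.
Variables (R : realType) (N : nat).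
Local Notation phase := 'rV[R]_(N.-1 + N).
Implicit Types (x v : phase) (S : 'M[R]_N) (pi : bivector_field R (N.-1 + N)).

(** [pi] acts on the trace Hamiltonians as the member of the hierarchy of index
    [j + 1] should. *)
Definition has_level pi (j : nat) := poly_bivector_field pi /\
  forall m x, hamiltonian pi (@trace_hamiltonian R N m) x = power_flow (m + j)%N x.

Lemma hamiltonianZl c pi (f : phase -> R) x :
  hamiltonian (fun y => c *: pi y) f x = c *: hamiltonian pi f x.
Proof.
apply/rowP => i; rewrite !mxE mulr_sumr; apply: eq_bigr => k _.
by rewrite mxE mulrA.
Qed.

Lemma hamiltonianZr c pi (f : phase -> R) x : polyfun f ->
  hamiltonian pi (fun y => c * f y) x = c *: hamiltonian pi f x.
Proof.
move=> pf; apply/rowP => i; rewrite !mxE mulr_sumr; apply: eq_bigr => k _.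
rewrite (partial_mul k (polyfun_const _ c) pf) partial_const.
by rewrite mul0r add0r mulrCA.
Qed.

Lemma poly_bivectorZ c pi : poly_bivector_field pi ->
  poly_bivector_field (fun y => c *: pi y).
Proof.
move=> h i k; under eq_fun do rewrite mxE.
by apply: polyfun_mul; [exact: polyfun_const|exact: h].
Qed.

(** By the Leibniz rule [(L_X pi) dF_m] is
    [[X, V_(m+j)] - pi d(X F_m) = (m + j) V_(m+n+j) - (m + n + 1) V_(m+n+j)]; the
    factor left over does not depend on [m]. *)
Lemma has_level_Lie_derivative (X : vector_field R (N.-1 + N)) n c pi j :
  poly_vector_field X ->
  (forall m, dir X (@trace_hamiltonian R N m) =
     fun x => (m + n).+1%:R * trace_hamiltonian (m + n) x) ->
  (forall m x, bracket X (power_flow m) x = m%:R *: power_flow (m + n)%N x) ->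
  c * (j%:R - n.+1%:R) = 1 ->
  has_level pi j -> has_level (fun x => c *: Lie_derivative X pi x) (j + n).
Proof.
move=> pX dX bX hc [ppi h]; split=> [|m x].
  by apply: poly_bivectorZ; exact: poly_Lie_derivative.
have pF := @polyfun_trace_hamiltonian R N.
rewrite hamiltonianZl hamiltonian_Lie_derivative // dX hamiltonianZr //.
have -> : hamiltonian pi (@trace_hamiltonian R N m) = power_flow (m + j)%N.
  by apply/funext => y.
rewrite bX h addnAC -scalerBl scalerA addnA [(m + n + j)%N]addnAC.
have -> : (m + j)%:R - (m + n).+1%:R = j%:R - n.+1%:R :> R.
  by rewrite -addnS !natrD; ring.
by rewrite hc scale1r.
Qed.

Lemma has_level_X1 c pi j : c * (j%:R - 2) = 1 -> has_level pi j ->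
  has_level (fun x => c *: Lie_derivative (@master_X1 R N) pi x) j.+1.
Proof.
move=> hc h; rewrite -(addn1 j); apply: (has_level_Lie_derivative (n := 1)) => //.
- exact: poly_master_X1.
- move=> m; apply/funext => x; apply: (dir_trace_hamiltonian (K := lax_part1 x)).
  exact: Lax_master_X1.
- by move=> m x; rewrite bracket_master_X1 addn1.
Qed.

Lemma has_level_X2 c pi j : c * (j%:R - 3) = 1 -> has_level pi j ->
  has_level (fun x => c *: Lie_derivative (@master_X2 R N) pi x) j.+2.
Proof.
move=> hc h; rewrite -(addn2 j); apply: (has_level_Lie_derivative (n := 2)) => //.
- exact: poly_master_X2.
- move=> m; apply/funext => x; apply: (dir_trace_hamiltonian (K := lax_part2 x)).
  exact: Lax_master_X2.
- by move=> m x; rewrite bracket_master_X2 addn2.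
Qed.

Lemma has_level_pi1 : has_level (@toda_pi1 R N) 0.
Proof.
split=> [|m x]; first exact: poly_pi1.
rewrite addn0 (hamiltonian_pi1 (pow_tr m (Lax_tr x))) //.
exact: trace_hamiltonian_gradient.
Qed.

Lemma has_level_pi2 : has_level (@toda_pi2 R N) 1.
Proof.
split=> [|m x]; first exact: poly_pi2.
rewrite (hamiltonian_pi2 (pow_tr m (Lax_tr x)) (Lax_pow_comm x m)).
  by rewrite addn1 /power_flow /toda_flow /mk_vector_field exprS.
exact: trace_hamiltonian_gradient.
Qed.

(** The factors [j - n - 1] are -1 for [pi_3], -2 for [pi_4] and [k + 1] for
    [pi_(k+5)]: the step from [pi_3] to [pi_4] along [X_1] would have factor 0,
    which is why [X_2] enters. *)
Lemma has_level_toda_pi j : has_level (@toda_pi R N j.+1) j.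
Proof.
have h3 : has_level (@toda_pi R N 3) 2.
  have -> : @toda_pi R N 3 =
      fun x => -1 *: Lie_derivative (@master_X1 R N) (@toda_pi2 R N) x.
    by apply/funext => x; rewrite scaleN1r.
  by apply: has_level_X1 has_level_pi2; ring.
have h4 : has_level (@toda_pi R N 4) 3.
  by apply: has_level_X2 has_level_pi2; field.
case: j => [|[|[|j]]]; [exact: has_level_pi1|exact: has_level_pi2|exact: h3|].
elim: j => [|j IH]; first exact: h4.
apply: has_level_X1 IH.
have -> : j.+3%:R - 2 = j.+1%:R :> R by rewrite -addn2 natrD; ring.
by rewrite mulVf // pnatr_eq0.
Qed.

End Hierarchy.

(** * The logarithm of the determinant *)

Section LogDeterminant.

(** Cayley-Hamilton: the constant coefficient of the characteristic polynomial
    is invertible, so its equation can be solved for the inverse. *)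
Lemma invmx_polynomial (F : fieldType) n (A : 'M[F]_n) : A \in unitmx ->
  exists d (c : nat -> F), invmx A = \sum_(m < d) c m *: A ^+ m.
Proof.
case: n A => [|n] A uA; first by exists 0%N, (fun=> 0); apply/matrixP => -[].
set p := char_poly A.
have p0 : p`_0 != 0.
  by rewrite char_poly_det mulf_neq0 ?signr_eq0 // -unitfE -unitmxE.
exists n.+1, (fun m => - (p`_0)^-1 * p`_m.+1).
have E : p`_0 *: 1 + \sum_(m < n.+1) p`_m.+1 *: A ^+ m.+1 = 0.
  rewrite -[RHS](Cayley_Hamilton A) -/p -[in RHS](coefK p) size_char_poly.
  rewrite poly_def [in RHS]big_ord_recl rmorphD rmorph_sum /= horner_mxZ rmorph1.
  by congr (_ + _); apply: eq_bigr => m _; rewrite horner_mxZ rmorphXn /= horner_mx_X.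
set T := (X in invmx A = X).
suff AT : A *m T = 1%:M by rewrite -[RHS](mulKmx uA) AT mulmx1.
rewrite /T mulmx_sumr.
under eq_bigr do rewrite -scalemxAr -[A *m _]/(A * A ^+ _) -exprS -scalerA.
rewrite -scaler_sumr; move/eqP: E; rewrite addrC addr_eq0 => /eqP->.
by rewrite scalerN scaleNr opprK scalerA mulVf // scale1r.
Qed.

Variable R : realType.

Lemma is_derive_bigprod (V : normedModType R) (I : eqType) (r : seq I)
    (f : I -> V -> R) (d : I -> R) x v :
  uniq r -> (forall i, is_derive x v (f i) (d i)) ->
  is_derive x v (fun y => \prod_(i <- r) f i y)
    (\sum_(i <- r) d i * \prod_(k <- r | i != k) f k x).
Proof.
move=> + hf; elim: r => [_|a r IH /= /andP[ar ur]].
  by rewrite big_nil; under eq_fun do rewrite big_nil; exact: is_derive_cst.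
under eq_fun do rewrite big_cons.
apply: is_derive_eq (is_deriveM (hf a) (IH ur)) _.
rewrite big_cons big_cons eqxx /= addrC; congr (_ + _).
  rewrite [LHS]mulrC; congr (_ * _); rewrite /= [LHS]big_seq [RHS]big_seq_cond.
  apply: eq_bigl => k; case kr: (k \in r) => //=; apply/esym.
  by apply: contraNneq ar => ->.
rewrite /GRing.scale /= mulr_sumr [LHS]big_seq [RHS]big_seq.
apply: eq_bigr => i ir; rewrite big_cons.
have -> : i != a by apply: contraNneq ar => <-.
by rewrite mulrCA.
Qed.

(** Jacobi's formula: the Leibniz expansion of the determinant, differentiated
    factor by factor, regroups into cofactors. *)
Lemma is_derive_det (V : normedModType R) n (A : V -> 'M[R]_n) (dA : 'M[R]_n) x v :
  (forall i j, is_derive x v (fun y => A y i j) (dA i j)) ->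
  is_derive x v (fun y => \det (A y)) (\tr (dA *m \adj (A x))).
Proof.
move=> hA.
have -> : \tr (dA *m \adj (A x)) = \sum_(s : 'S_n) (-1) ^+ s *
    \sum_(i < n) dA i (s i) * \prod_(k < n | i != k) A x k (s k).
  under [RHS]eq_bigr do rewrite mulr_sumr.
  rewrite exchange_big /=; apply: eq_bigr => i _; rewrite mxE.
  rewrite [RHS](partition_big (fun s : 'S_n => s i) predT) //=.
  apply: eq_bigr => j _; rewrite mxE expand_cofactor mulr_sumr.
  by apply: eq_bigr => s /eqP ->; rewrite mulrCA.
rewrite /determinant.
suff h (s : 'S_n) : is_derive x v (fun y => (-1) ^+ s * \prod_i A y i (s i))
    ((-1) ^+ s * \sum_(i < n) dA i (s i) * \prod_(k < n | i != k) A x k (s k)).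
  elim: (index_enum _) => [|s r IH].
    by rewrite big_nil; under eq_fun do rewrite big_nil; exact: is_derive_cst.
  by rewrite big_cons; under eq_fun do rewrite big_cons; exact: is_deriveD.
have := @is_derive_bigprod _ _ (index_enum _) (fun i y => A y i (s i)) _ x v
  (index_enum_uniq _) (fun i => hA i (s i)).
by move=> h; exact: (is_deriveZ ((-1) ^+ s) h).
Qed.

(** Directional derivatives are derivatives of a function of one real variable,
    where the chain rule for the logarithm applies. *)
Lemma is_derive_line (V : normedModType R) (f : V -> R) x v d :
  is_derive x v f d <-> is_derive (0 : R) (1 : R) (fun h : R => f (h *: v + x)) d.
Proof.
have E : (fun h : R => h^-1 *: ((f \o shift x) (h *: v) - f x)) =
         (fun h : R => h^-1 *:
            (((fun k => f (k *: v + x)) \o shift 0) (h *: (1 : R))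
             - f (0 *: v + x))).
  by apply/funext => h /=; rewrite scale0r add0r addr0 [h *: (1 : R)]mulr1.
by split=> -[h1 h2]; split; rewrite /derivable /derive ?E // -?E.
Qed.

Lemma is_derive_ln_comp (V : normedModType R) (f : V -> R) x v d :
  0 < f x -> is_derive x v f d -> is_derive x v (fun y => ln (f y)) (d / f x).
Proof.
move=> fx /is_derive_line h; apply/is_derive_line.
have hl : is_derive (f (0 *: v + x)) (1 : R) (@ln R) (f x)^-1.
  by rewrite scale0r add0r; exact: is_derive1_ln.
rewrite mulrC; exact: is_derive1_comp hl h.
Qed.

Variable N : nat.
Local Notation phase := 'rV[R]_(N.-1 + N).
Implicit Types (x v : phase) (S : 'M[R]_N) (pi : bivector_field R (N.-1 + N)).

Lemma ln_det_gradient x : 0 < \det (Lax x) ->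
  has_gradient (@ln_det_Lax R N) x (invmx (Lax x)).
Proof.
move=> dx k; apply: is_derive_partial; apply: is_derive_eq.
  apply: is_derive_ln_comp => //; apply: is_derive_det; exact: mx_derive_Lax.
have ux : Lax x \in unitmx by rewrite unitmxE unitfE gt_eqF.
by rewrite /invmx ux -scalemxAl mxtraceZ mxtrace_mulC mulrC.
Qed.

Lemma toda_flow_sum x d (c : nat -> R) (S : nat -> 'M[R]_N) :
  toda_flow (fun=> \sum_(m < d) c m *: S m) x =
  \sum_(m < d) c m *: toda_flow (fun=> S m) x.
Proof.
have e0 j k : entry1 (0 : 'M[R]_N) j k = 0.
  by have := entry1Z 0 (0 : 'M[R]_N) j k; rewrite scale0r mul0r.
elim: d => [|d IH].
  rewrite !big_ord0; apply/rowP => k; rewrite !mxE.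
  by case: splitP => i _; rewrite !mxE /flow_a /flow_b !e0; ring.
rewrite !big_ord_recr /= -IH; apply/rowP => k; rewrite !mxE.
by case: splitP => i _; rewrite !mxE /flow_a /flow_b !entry1D !entry1Z; ring.
Qed.

Lemma hamiltonian_gradient_sum pi f x S d (c : nat -> R) :
  S = \sum_(m < d) c m *: Lax x ^+ m -> has_gradient f x S ->
  hamiltonian pi f x =
  \sum_(m < d) c m *: hamiltonian pi (@trace_hamiltonian R N m) x.
Proof.
move=> eS hf; apply/rowP => i; rewrite mxE summxE.
under [RHS]eq_bigr do rewrite !mxE mulr_sumr.
rewrite exchange_big; apply: eq_bigr => k _ /=.
rewrite hf eS mulmx_suml raddf_sum /= mulr_sumr; apply: eq_bigr => m _.
by rewrite -scalemxAl mxtraceZ trace_hamiltonian_gradient mulrCA.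
Qed.

End LogDeterminant.

Theorem theorem2 (R : realType) (N : nat) (hN : (2 <= N)%N)
    (j : nat) (hj : (1 <= j)%N) (x : 'rV[R]_(N.-1 + N))
    (hdet : 0 < \det (Lax x)) :
  hamiltonian (@toda_pi R N j) (@toda_H1 R N) x
  = hamiltonian (@toda_pi R N j.+1) (@ln_det_Lax R N) x.
Proof.
case: j hj => // j _.
have ux : Lax x \in unitmx by rewrite unitmxE unitfE gt_eqF.
have [d [c ec]] := invmx_polynomial ux.
rewrite (hamiltonian_gradient_sum _ ec (ln_det_gradient hdet)).
have [_ flow_j] := has_level_toda_pi R N j.
have [_ flow_j1] := has_level_toda_pi R N j.+1.
have -> : @toda_H1 R N = trace_hamiltonian 0.
  by apply/funext => y; rewrite /trace_hamiltonian expr1 divr1.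
rewrite flow_j; under eq_bigr do rewrite flow_j1.
rewrite -(toda_flow_sum x d c (fun m => Lax x ^+ (m + j.+1))).
rewrite /power_flow /toda_flow /mk_vector_field add0n.
have -> : \sum_(m < d) c m *: Lax x ^+ (m + j.+1) = Lax x ^+ j; last by [].
under eq_bigr do rewrite exprD -[_ * _]/(_ *m _) scalemxAl.
by rewrite -mulmx_suml -ec exprS; exact: mulKmx.
Qed.
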